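(* Let $S,\Theta,(E,\mathcal{E},Q),\varphi,f,G,\{G_N\},\{\tau_N\}$, the data process $\tilde{\mathbf s}=\{\tilde s_n\}_{n\ge1}$ and the measure $\lambda=\gamma\times\tilde\gamma$ be as in the context, with $\theta^0$ the unique minimizer of $G(E_\theta(f),\bar f)$ over $\theta\in\Theta$. Assume that the process $\tilde{\mathbf s}$ is stationary and ergodic and that (A.1)–(A.5) (listed in the context) hold. Let $\{\hat\theta_N(s_0,\omega,\tilde{\mathbf s})\}_{N\ge1}$ be a simulated moments estimator (SME) as defined in the context. Then, for all $s_0\in S$ and $\lambda$-almost all $(\omega,\tilde{\mathbf s})$, $\hat\theta_N(s_0,\omega,\tilde{\mathbf s})\to\theta^0$ as $N\to\infty$.
   Context: Setting. $S=\{s\in\mathbb{R}^k : a_i\le s_i\le b_i,\ i=1,\dots,k\}$ with constants $a_i<b_i$, with Borel $\sigma$-algebra $\mathcal{S}$; $\geq$ is the coordinatewise partial order on Euclidean space. $(E,\mathcal{E})$ is a measurable space with a probability law $Q$ (the law of the i.i.d. shocks $\varepsilon$). $\Omega$ is the space of sequences $\omega=\{\varepsilon_n\}_{n\ge1}$ in $E$, with the product probability $\gamma$ constructed from $Q$. $\Theta\subset\mathbb{R}^l$ is compact, with its Borel $\sigma$-algebra. $\varphi:S\times E\times\Theta\to S$ is a function. A function $h$ on $S$ is increasing if $h(s)\ge h(s')$ whenever $s\ge s'$. For $s_0\in S$, $\omega=\{\varepsilon_n\}_{n\ge1}\in\Omega$ and $\theta\in\Theta$, the path $\{s_n(s_0,\omega,\theta)\}_{n\ge1}$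 is defined recursively by $s_n(s_0,\omega,\theta)=\varphi(s_{n-1}(s_0,\omega,\theta),\varepsilon_n,\theta)$, $n\ge1$, starting at $s_0$. For a measurable map $\psi:S\times E\to S$, a Borel probability $\mu$ on $S$ is an invariant probability of $\psi$ if $\mu(A)=\int_S Q(\{\varepsilon:\psi(s,\varepsilon)\in A\})\,\mu(ds)$ for all $A\in\mathcal{S}$. Let $e=(1,\dots,1)\in\mathbb{R}^k$ and let $\mathrm{proj}_S$ be the nearest-point (Euclidean) projection of $\mathbb{R}^k$ onto $S$. For $\kappa>0$ define $$\varphi^\kappa(s,\varepsilon,\theta)=\mathrm{proj}_S[\varphi(\mathrm{proj}_S[s+\kappa e],\varepsilon,\theta)+\kappa e],\qquad \varphi_\kappa(s,\varepsilon,\theta)=\mathrm{proj}_S[\varphi(\mathrm{proj}_S[s-\kappa e],\varepsilon,\theta)-\kappa e].$$ For functions on $S\times E$, $\psi\ge\psi'$ means $\psi(s,\varepsilon)\ge\psi'(s,\varepsilon)$ for all $(s,\varepsilon)$. Assumptions: (A.1) $\varphi$ is measurable with respect to the product $\sigma$-algebra on $S\times E\times\Theta$. (A.2) For each $(\varepsilon,\theta)$, the mapping $\varphi(\cdot,\varepsilon,\theta):S\to S$ is increasing. (A.3) For every fixed $\theta$ and every continuous $g:S\to\mathbb{R}$, $\int g(\varphi(s_j,\varepsilon,\theta))Q(d\varepsilon)\to\int g(\varphi(s,\varepsilon,\theta))Q(d\varepsilon)$ whenever $s_j\to s$ in $S$. (A.4) For every $\theta\in\Theta$ and $\kappa>0$,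 the set $\{\theta'\in\Theta:\varphi^\kappa(\cdot,\cdot,\theta)\ge\varphi(\cdot,\cdot,\theta')\ge\varphi_\kappa(\cdot,\cdot,\theta)\}$ contains an open neighborhood $V_\kappa(\theta)$ of $\theta$ (relative to $\Theta$). (A.5) For every $\theta\in\Theta$, the mapping $\varphi(\cdot,\cdot,\theta)$ has a unique invariant probability $\mu_\theta$. Data. $\tilde{\mathbf s}=\{\tilde s_n\}_{n\ge1}$ is an $S$-valued stochastic process (observations of the data generating process) with law $\tilde\gamma$ on the space of sequences; $\lambda=\gamma\times\tilde\gamma$ is the product measure on pairs $(\omega,\tilde{\mathbf s})$. Estimator. $f:S\to\mathbb{R}^p$ is continuous and increasing; $E_\theta(f)=\int f(s)\,\mu_\theta(ds)$; $\bar f$ is the expected value of $f$ under the invariant (stationary one-period) distribution of the data generating process. $G:\mathbb{R}^p\times\mathbb{R}^p\to\mathbb{R}$ is continuous, and $\theta^0=\arg\min_{\theta\in\Theta}G(E_\theta(f),\bar f)$ is assumed to be unique. For each $N\ge1$, $G_N(\cdot,\cdot,\omega,\tilde{\mathbf s}):\mathbb{R}^p\times\mathbb{R}^p\to\mathbb{R}$ is continuous, and for $\lambda$-almost all $(\omega,\tilde{\mathbf s})$ the sequence $\{G_N(\cdot,\cdot,\omega,\tilde{\mathbf s})\}_{N\ge1}$ converges uniformly to $G(\cdot,\cdot)$. The functions $\tau_N(\omega,\tilde{\mathbf s})$ take positive integer values and $\tau_N(\omega,\tilde{\mathbf s})\to\infty$ as $N\to\infty$ for $\lambda$-almost all $(\omega,\tilde{\mathbf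 s})$. A simulated moments estimator (SME) is a sequence of measurable $\Theta$-valued functions $\{\hat\theta_N(s_0,\omega,\tilde{\mathbf s})\}_{N\ge1}$ such that, for each $N$, for all $s_0\in S$ and $\lambda$-almost all $(\omega,\tilde{\mathbf s})$, $\hat\theta_N(s_0,\omega,\tilde{\mathbf s})$ attains $$\inf_{\theta\in\Theta}G_N\left(\frac{1}{\tau_N(\omega,\tilde{\mathbf s})}\sum_{n=1}^{\tau_N(\omega,\tilde{\mathbf s})}f(s_n(s_0,\omega,\theta)),\ \frac1N\sum_{n=1}^N f(\tilde s_n),\ \omega,\ \tilde{\mathbf s}\right).$$ Convention: ''for all $s_0$ and $\lambda$-almost all $(\omega,\tilde{\mathbf s})$'' means that there is a set of full $\lambda$-measure, not depending on $s_0$, such that the property holds for all $s_0\in S$ and all $(\omega,\tilde{\mathbf s})$ in that set. *)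

(* Defs.v *)
From HB Require Import structures.
From mathcomp Require Import all_boot all_order all_algebra.
From mathcomp Require Import all_classical all_reals all_analysis.

Set Implicit Arguments.
Unset Strict Implicit.
Unset Printing Implicit Defensive.
Import Order.TTheory GRing.Theory Num.Theory.
Import numFieldNormedType.Exports.

Local Open Scope classical_set_scope.
Local Open Scope ring_scope.

(* A nonempty subset of a topological space as a type, carrying the subspace
   topology and its Borel sigma-algebra. The proof of nonemptiness is a
   parameter only because measurableType extends pointedType. *)
Definition borel_sub (X : topologicalType) (A : set X) (A0 : A !=set0) : Type :=
  set_type A.

Section borel_sub_instances.
Variables (X : topologicalType) (A : set X) (A0 : A !=set0).

Definition borel_sub_point : borel_sub A0 :=
  exist _ (sval (cid A0)) (mem_set (svalP (cid A0))).

HB.instance Definition _ := Choice.copy (borel_sub A0) (set_type A).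
HB.instance Definition _ := Topological.copy (borel_sub A0) (set_type A).
HB.instance Definition _ := isPointed.Build (borel_sub A0) borel_sub_point.
HB.instance Definition _ := Measurable.copy (borel_sub A0)
  (g_sigma_algebraType (@open (borel_sub A0))).

End borel_sub_instances.

(* Sequences in T, with the product sigma-algebra. A sequence x_1, x_2, ... is
   encoded as w : nat -> T with w n = x_(n+1). *)
Definition seqspace (T : Type) : Type := nat -> T.

Definition cylinders d (T : measurableType d) : set (set (seqspace T)) :=
  [set C | exists n (B : set T), measurable B /\ C = [set w | B (w n)]].

HB.instance Definition _ (T : pointedType) :=
  Pointed.copy (seqspace T) (nat -> T).
HB.instance Definition _ d (T : measurableType d) :=
  Measurable.copy (seqspace T) (g_sigma_algebraType (@cylinders d T)).

Definition seq_shift (T : Type) (w : seqspace T) : seqspace T := fun n => w n.+1.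

(* gam is the product probability Q x Q x ... on sequences; it is determined on
   the product sigma-algebra by its values on finite-dimensional rectangles. *)
Definition product_law d (T : measurableType d) (R : realType)
    (Q : probability T R) (gam : probability (seqspace T) R) : Prop :=
  forall (n : nat) (B : nat -> set T), (forall i, measurable (B i)) ->
    gam [set w | forall i, (i < n)%N -> B i (w i)] = (\prod_(i < n) Q (B i))%E.

Definition stationary d (T : measurableType d) (R : realType)
    (P : probability (seqspace T) R) : Prop :=
  forall B : set (seqspace T), measurable B -> P (@seq_shift T @^-1` B) = P B.

Definition ergodic d (T : measurableType d) (R : realType)
    (P : probability (seqspace T) R) : Prop :=
  forall B : set (seqspace T), measurable B -> @seq_shift T @^-1` B = B ->
    P B = 0%E \/ P B = 1%E.

Section euclidean.
Variable R : realType.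

Definition vle n (x y : 'rV[R]_n) : Prop := forall i, x 0 i <= y 0 i.

(* The norm provided by the library on 'rV[R]_n is the sup norm. *)
Definition enorm n (x : 'rV[R]_n) : R := Num.sqrt (\sum_i x 0 i ^+ 2).

Definition box k (a b : 'rV[R]_k) : set 'rV[R]_k :=
  [set s | forall i, a 0 i <= s 0 i <= b 0 i].

Lemma box_nonempty k (a b : 'rV[R]_k) (ab : forall i, a 0 i < b 0 i) :
  box a b !=set0.
Proof. by exists a => i; rewrite lexx ltW. Qed.

Definition nearest_point n (A : set 'rV[R]_n) (A0 : A !=set0) (x : 'rV[R]_n) :
    borel_sub A0 :=
  get [set s : borel_sub A0 |
    forall s' : borel_sub A0, enorm (x - \val s) <= enorm (x - \val s')].

End euclidean.

Notation state ab := (borel_sub (box_nonempty ab)).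

Section model.
Context (R : realType) (k : nat) (a b : 'rV[R]_k) (ab : forall i, a 0 i < b 0 i).
Context (d : measure_display) (E : measurableType d).
Local Notation S := (state ab).

Definition state_le (s s' : S) : Prop := vle (\val s) (\val s').

(* For c > 0, the perturbed maps of psi are perturb c psi (upper) and
   perturb (- c) psi (lower). *)
Definition perturb (c : R) (psi : S -> E -> S) (s : S) (e : E) : S :=
  let pr := nearest_point (box_nonempty ab) in
  pr (\val (psi (pr (\val s + c *: const_mx 1)) e) + c *: const_mx 1).

Definition shock_le (psi psi' : S -> E -> S) : Prop :=
  forall s e, state_le (psi s e) (psi' s e).

Fixpoint sim_path (psi : S -> E -> S) (s0 : S) (w : seqspace E) (n : nat) : S :=
  if n is m.+1 then psi (sim_path psi s0 w m) (w m) else s0.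

Definition invariant_probability (Q : probability E R) (psi : S -> E -> S)
    (mu : probability S R) : Prop :=
  forall B : set S, measurable B ->
    mu B = (\int[mu]_s Q [set e | B (psi s e)])%E.

(* Uniqueness is as a measure on the Borel sigma-algebra: the values of a
   library measure on non-measurable sets are arbitrary. *)
Definition unique_invariant_probability (Q : probability E R)
    (psi : S -> E -> S) (mu : probability S R) : Prop :=
  invariant_probability Q psi mu /\
  forall nu : probability S R, invariant_probability Q psi nu ->
    forall B : set S, measurable B -> nu B = mu B.

Definition sim_mean p (f : S -> 'rV[R]_p) (psi : S -> E -> S) (s0 : S)
    (w : seqspace E) (T : nat) : 'rV[R]_p :=
  T%:R^-1 *: \sum_(1 <= n < T.+1) f (sim_path psi s0 w n).

Definition data_mean p (f : S -> 'rV[R]_p) (st : seqspace S) (N : nat) :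
    'rV[R]_p :=
  N%:R^-1 *: \sum_(0 <= n < N) f (st n).

End model.

Definition vmean d (T : measurableType d) (R : realType) p
    (P : probability T R) (h : T -> 'rV[R]_p) : 'rV[R]_p :=
  \row_j \int[P]_x h x 0 j.

Definition minimizer (T : Type) (R : realType) (h : T -> R) (x : T) : Prop :=
  forall y, h x <= h y.

(* The infimum is taken in the extended reals, since the real-valued inf is 0
   on sets that are not bounded below. *)
Definition attains_inf (T : Type) (R : realType) (h : T -> R) (x : T) : Prop :=
  (h x)%:E = ereal_inf (range (EFin \o h)).

(* Main.v *)
(* For a monotone random map started from the greatest state of the box, the
   backward iterates decrease, hence converge, and by the Feller property (A.3)
   the law of their limit is invariant; by uniqueness it is mu_theta. Hence the
   n-step transition operator applied to f at the greatest state tends to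
   E_theta(f), and the same holds from the least state. For fixed m the m-step
   operator of the perturbed map tends to that of the original map as kappa tends
   to 0. A path of any theta' in V_kappa(theta), from any s_0, is dominated at
   time n + m by m steps of the perturbed map from the greatest state driven by
   the shifted shocks. These are a stationary ergodic sequence, so the ergodic
   theorem (proved from the maximal ergodic inequality) bounds the sample means
   of f uniformly in theta' in a neighbourhood of theta and in s_0. Away from
   theta^0 the sample objective is therefore eventually larger than at theta^0,
   locally uniformly, and compactness of Theta concludes. *)

Require Import Defs.
From HB Require Import structures.
From mathcomp Require Import all_boot all_order all_algebra.
From mathcomp Require Import all_classical all_reals all_analysis.
From mathcomp Require Import measurable_realfun lra ring.

Set Implicit Arguments.
Unset Strict Implicit.
Unset Printing Implicit Defensive.
Import Order.TTheory GRing.Theory Num.Theory.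
Import numFieldNormedType.Exports.

Local Open Scope classical_set_scope.
Local Open Scope ring_scope.

(** * Bounded measurable functions *)

(** Such functions are integrable against every probability, so their integrals can be handled in
    [R] rather than in the extended reals. *)
Definition bounded_measurable d (T : measurableType d) (R : realType)
    (h : T -> R) : Prop :=
  measurable_fun setT h /\ exists M, forall x, `|h x| <= M.

Section bounded_measurable.
Context d (T : measurableType d) (R : realType).
Implicit Types (h g : T -> R) (P : probability T R).

Lemma bounded_measurable_integrable P h :
  bounded_measurable h -> P.-integrable setT (EFin \o h).
Proof.
move=> [mh [M hM]]; apply: measurable_bounded_integrable => //=.
  by rewrite probability_setT ltry.
by exists M; split; [exact: num_real|move=> x Mx y _; exact/(le_trans (hM y))/ltW].
Qed.

Lemma bounded_measurable_cst c : bounded_measurable (fun _ : T => c : R).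
Proof. by split; [exact: measurable_cst|exists `|c|]. Qed.

Lemma bounded_measurableD h g : bounded_measurable h -> bounded_measurable g ->
  bounded_measurable (fun x => h x + g x).
Proof.
move=> [mh [M hM]] [mg [M' gM]]; split; first exact: measurable_funD.
by exists (M + M') => x; rewrite (le_trans (ler_normD _ _))// lerD.
Qed.

Lemma bounded_measurableN h : bounded_measurable h ->
  bounded_measurable (fun x => - h x).
Proof.
move=> [mh [M hM]]; split; first exact: measurableT_comp.
by exists M => x; rewrite normrN.
Qed.

Lemma bounded_measurableB h g : bounded_measurable h -> bounded_measurable g ->
  bounded_measurable (fun x => h x - g x).
Proof. by move=> ? ?; apply/bounded_measurableD => //; exact/bounded_measurableN. Qed.

Lemma bounded_measurable_max h g : bounded_measurable h -> bounded_measurable g ->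
  bounded_measurable (fun x => Num.max (h x) (g x)).
Proof.
move=> [mh [M hM]] [mg [M' gM]]; split; first exact: measurable_maxr.
exists (Num.max M M') => x; case: (leP (h x) (g x)) => _.
  by rewrite (le_trans (gM x))// le_max lexx orbT.
by rewrite (le_trans (hM x))// le_max lexx.
Qed.

Lemma bounded_measurable_sum (I : Type) (s : seq I) (h : I -> T -> R) :
  (forall i, bounded_measurable (h i)) ->
  bounded_measurable (fun x => \sum_(i <- s) h i x).
Proof.
move=> bh; elim: s => [|i s IH].
  under eq_fun do rewrite big_nil; exact: bounded_measurable_cst.
by under eq_fun do rewrite big_cons; exact: bounded_measurableD.
Qed.

Lemma bounded_measurable_indic (A : set T) : measurable A ->
  bounded_measurable (\1_A : T -> R).
Proof.
move=> mA; split; first exact: measurable_indic.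
by exists 1 => x; rewrite indicE; case: (x \in A); rewrite ?normr1 ?normr0.
Qed.

Lemma bounded_measurable_comp d' (T' : measurableType d') (phi : T' -> T) h :
  measurable_fun setT phi -> bounded_measurable h ->
  bounded_measurable (fun x => h (phi x)).
Proof.
move=> mphi [mh [M hM]]; split; first exact: measurableT_comp.
by exists M => x.
Qed.

Lemma Rintegral_prob_cst P c : \int[P]_x c = c :> R.
Proof.
rewrite Rintegral_cst// (_ : fine _ = 1) ?mulr1//.
by rewrite -[1]/(fine 1%E); congr fine; exact: probability_setT.
Qed.

Lemma EFin_Rintegral P h : bounded_measurable h ->
  (\int[P]_x h x)%:E = (\int[P]_x (h x)%:E)%E.
Proof.
move=> bh; rewrite /Rintegral fineK//; apply: integrable_fin_num => //.
exact: bounded_measurable_integrable.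
Qed.

Lemma le_Rintegral_prob P h g : bounded_measurable h -> bounded_measurable g ->
  (forall x, h x <= g x) -> \int[P]_x h x <= \int[P]_x g x.
Proof.
move=> bh bg hg; apply: le_Rintegral => //;
  exact: bounded_measurable_integrable.
Qed.

Lemma RintegralB_prob P h g : bounded_measurable h -> bounded_measurable g ->
  \int[P]_x (h x - g x) = \int[P]_x h x - \int[P]_x g x.
Proof.
by move=> bh bg; apply: RintegralB => //; exact: bounded_measurable_integrable.
Qed.

Lemma RintegralN_prob P h : bounded_measurable h ->
  \int[P]_x (- h x) = - \int[P]_x h x.
Proof.
move=> bh; have := RintegralB_prob P (bounded_measurable_cst 0) bh.
by rewrite Rintegral_prob_cst sub0r; under eq_Rintegral do rewrite sub0r.
Qed.

Lemma norm_Rintegral_le P h c : bounded_measurable h ->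
  (forall x, `|h x| <= c) -> `|\int[P]_x h x| <= c.
Proof.
move=> bh hc; have bc := bounded_measurable_cst c.
rewrite ler_norml -{2}(Rintegral_prob_cst P c) le_Rintegral_prob//; last first.
  by move=> x; rewrite (le_trans (ler_norm _)).
rewrite andbT -[- c](Rintegral_prob_cst P) le_Rintegral_prob//.
  exact: bounded_measurable_cst.
by move=> x; move: (hc x); rewrite ler_norml => /andP[].
Qed.

(** Dominated convergence with the constant [M] as dominating function. Convergence is almost
    everywhere because the maximal ergodic inequality has it only on a set of full measure. *)
Lemma bounded_cvg_Rintegral P (h : nat -> T -> R) (g : T -> R) M :
  (forall n, measurable_fun setT (h n)) -> (forall n x, `|h n x| <= M) ->
  {ae P, forall x, (fun n => h n x) @ \oo --> g x} -> bounded_measurable g ->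
  (fun n => \int[P]_x h n x) @ \oo --> \int[P]_x g x.
Proof.
move=> mh hM hg bg.
have bh n : bounded_measurable (h n) by split => //; exists M.
have [|||||_ _] := @dominated_convergence _ T R P setT measurableT
  (fun n => EFin \o h n) (EFin \o g) (EFin \o cst M).
- by move=> n; apply/measurable_EFinP.
- by apply/measurable_EFinP; case: bg.
- apply: filterS hg => x hx _; by apply/fine_cvgP; split; [exact: nearW|exact: hx].
- exact/bounded_measurable_integrable/bounded_measurable_cst.
- by apply/aeW => x n _ /=; rewrite lee_fin.
by rewrite -EFin_Rintegral// => /fine_cvgP[_].
Qed.

End bounded_measurable.

(** * Image laws *)

Section image_law.
Context d (T : measurableType d) (R : realType) (P : probability T R).
Context d' (T' : measurableType d') (phi : T -> T').
Hypothesis mphi : measurable_fun setT phi.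

Definition image_law : probability T' R :=
  distribution P (MeasurableFun.Pack
    (MeasurableFun.Class (isMeasurableFun.Build _ _ _ _ _ mphi))).

Lemma image_lawE (A : set T') : image_law A = P (phi @^-1` A).
Proof. by []. Qed.

Lemma Rintegral_image_law (g : T' -> R) : bounded_measurable g ->
  \int[image_law]_x g x = \int[P]_x g (phi x).
Proof.
move=> bg; rewrite /Rintegral; congr fine.
rewrite (integral_pushforward mphi)//.
- by apply/measurable_EFinP; case: bg.
- exact/bounded_measurable_integrable/(bounded_measurable_comp mphi).
Qed.

End image_law.

Lemma Rintegral_eq_law d (T : measurableType d) (R : realType)
    (P P' : probability T R) (h : T -> R) :
  (forall A, measurable A -> P A = P' A) -> \int[P]_x h x = \int[P']_x h x.
Proof.
move=> PP'; rewrite /Rintegral; congr fine.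
by apply: eq_measure_integral => A mA _; exact: PP'.
Qed.

(** * Fubini for bounded functions *)

Section fubini.
Context d (T : measurableType d) d' (T' : measurableType d') (R : realType).
Variables (P : probability T R) (P' : probability T' R) (F : T * T' -> R).
Hypothesis bF : bounded_measurable F.

Lemma bounded_measurable_section1 y : bounded_measurable (fun x => F (x, y)).
Proof. exact/(bounded_measurable_comp _ bF)/pair2_measurable. Qed.

Lemma bounded_measurable_section2 x : bounded_measurable (fun y => F (x, y)).
Proof. exact/(bounded_measurable_comp _ bF)/pair1_measurable. Qed.

Lemma bounded_measurable_Rintegral2 :
  bounded_measurable (fun x => \int[P']_y F (x, y)).
Proof.
split.
  apply/measurable_EFinP.
  rewrite (_ : _ \o _ = fun x => \int[P']_y (F (x, y))%:E)%E; last first.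
    by apply/funext => x /=; rewrite EFin_Rintegral//; exact: bounded_measurable_section2.
  apply: (@measurable_fubini_F _ _ _ _ _ P P' (EFin \o F)).
  exact: bounded_measurable_integrable.
have [_ [M FM]] := bF.
exists M => x; apply: norm_Rintegral_le => //; exact: bounded_measurable_section2.
Qed.

Lemma bounded_measurable_Rintegral1 :
  bounded_measurable (fun y => \int[P]_x F (x, y)).
Proof.
split.
  apply/measurable_EFinP.
  rewrite (_ : _ \o _ = fun y => \int[P]_x (F (x, y))%:E)%E; last first.
    by apply/funext => y /=; rewrite EFin_Rintegral//; exact: bounded_measurable_section1.
  apply: (@measurable_fubini_G _ _ _ _ _ P P' (EFin \o F)).
  exact: bounded_measurable_integrable.
have [_ [M FM]] := bF.
exists M => y; apply: norm_Rintegral_le => //; exact: bounded_measurable_section1.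
Qed.

Lemma Rintegral12_prod :
  \int[P]_x \int[P']_y F (x, y) = \int[(P \x P')%E]_z F z.
Proof.
apply: EFin_inj; rewrite EFin_Rintegral; last exact: bounded_measurable_Rintegral2.
rewrite EFin_Rintegral// -integral12_prod_meas1//=; last first.
  exact: bounded_measurable_integrable.
apply: eq_integral => x _; rewrite EFin_Rintegral//.
exact: bounded_measurable_section2.
Qed.

Lemma Rintegral21_prod :
  \int[P']_y \int[P]_x F (x, y) = \int[(P \x P')%E]_z F z.
Proof.
apply: EFin_inj; rewrite EFin_Rintegral; last exact: bounded_measurable_Rintegral1.
rewrite EFin_Rintegral// -integral21_prod_meas1//=; last first.
  exact: bounded_measurable_integrable.
apply: eq_integral => y _; rewrite EFin_Rintegral//.
exact: bounded_measurable_section1.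
Qed.

End fubini.

(** * Sequence spaces and product laws *)

Section seqspace.
Context d (T : measurableType d).

Lemma measurable_coord n : measurable_fun setT (fun w : seqspace T => w n).
Proof.
move=> _ B mB; rewrite setTI; apply: sub_sigma_algebra.
by exists n, B.
Qed.

Lemma measurable_seqspaceP d' (X : measurableType d') (phi : X -> seqspace T) :
  (forall n, measurable_fun setT (fun x => phi x n)) -> measurable_fun setT phi.
Proof.
move=> mphi; apply: (measurability (@cylinders d T)) => //.
by move=> _ [_ [n [B [mB ->]]] <-]; exact: mphi.
Qed.

Lemma measurable_seq_shift : measurable_fun setT (@seq_shift T).
Proof. by apply: measurable_seqspaceP => n; exact: measurable_coord. Qed.

Lemma measurable_iter_seq_shift n : measurable_fun setT (iter n (@seq_shift T)).
Proof.
elim: n => [|n IH]; first exact: measurable_id.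
exact: (measurableT_comp measurable_seq_shift IH).
Qed.

(** A generating class closed under intersection, unlike [cylinders], which constrain a single
    coordinate; [product_law] prescribes the measure exactly on these sets. *)
Definition rectangles : set (set (seqspace T)) :=
  [set C | exists n (B : nat -> set T), (forall i, measurable (B i)) /\
    C = [set w | forall i, (i < n)%N -> B i (w i)]].

Lemma measurable_rectangle n (B : nat -> set T) : (forall i, measurable (B i)) ->
  measurable [set w : seqspace T | forall i, (i < n)%N -> B i (w i)].
Proof.
move=> mB.
rewrite (_ : mkset _ =
    \bigcap_(i < n) ((fun w : seqspace T => w i) @^-1` B i)).
  apply: bigcap_measurableType.
  by move=> i _; rewrite -[X in measurable X]setTI; exact: measurable_coord.
by apply/seteqP; split => w /= wB i; exact: wB.
Qed.

Lemma measurable_seqspaceE :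
  @measurable _ (seqspace T) = <<s rectangles >>.
Proof.
apply/seteqP; split.
  apply: smallest_sub; first exact: smallest_sigma_algebra.
  move=> _ [n [B [mB ->]]]; apply: sub_sigma_algebra.
  exists n.+1, (fun i => if i == n then B else setT).
  split; first by move=> i; case: eqP.
  apply/seteqP; split => w /= wB; first by move=> i _; case: eqP => [->|].
  by have := wB n (ltnSn n); rewrite eqxx.
apply: smallest_sub; first exact: sigma_algebra_measurable.
by move=> _ [n [B [mB ->]]]; exact: measurable_rectangle.
Qed.

Lemma rectangles_setI : setI_closed rectangles.
Proof.
move=> _ _ [n [B [mB ->]]] [m [C [mC ->]]].
exists (maxn n m), (fun i => (if (i < n)%N then B i else setT) `&`
                             (if (i < m)%N then C i else setT)).
split; first by move=> i; apply: measurableI; case: ifP.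
apply/seteqP; split => w /=.
  move=> [wB wC] i _; split.
    by case: ifPn => // /wB.
  by case: ifPn => // /wC.
by move=> wBC; split => i im; have := wBC i; rewrite leq_max im ?orbT => /(_ isT) [].
Qed.

Lemma measure_unique_rectangles (R : realType)
    (m1 m2 : {measure set (seqspace T) -> \bar R}) :
  (m1 setT < +oo)%E ->
  (forall C, rectangles C -> m1 C = m2 C) ->
  forall C, measurable C -> m1 C = m2 C.
Proof.
move=> m1T m12 C mC; apply: (measure_unique rectangles (fun=> setT)) => //.
- exact: measurable_seqspaceE.
- exact: rectangles_setI.
- move=> _; exists 0%N, (fun=> setT); split => //.
  by apply/seteqP; split.
- by rewrite bigcup_const.
Qed.

End seqspace.

Lemma seq_shift_iter (T : Type) (w : seqspace T) n i :
  iter n (@seq_shift T) w i = w (n + i)%N.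
Proof. by elim: n i => [|n IH] i //=; rewrite /seq_shift IH addnS. Qed.

(** * Product laws: independence, stationarity, ergodicity *)

Section product_law.
Context d (T : measurableType d) (R : realType).
Variables (Q : probability T R) (gam : probability (seqspace T) R).
Hypothesis Hgam : product_law Q gam.

Definition head_shift (w : seqspace T) : T * seqspace T := (w 0%N, seq_shift w).

Lemma measurable_head_shift : measurable_fun setT head_shift.
Proof.
by apply: measurable_fun_pair; [exact: measurable_coord|exact: measurable_seq_shift].
Qed.

Definition cons_set (A : set T) (B : nat -> set T) : nat -> set T :=
  fun i => if i is j.+1 then B j else A.

Lemma measurable_cons_set A B : measurable A -> (forall i, measurable (B i)) ->
  forall i, measurable (cons_set A B i).
Proof. by move=> mA mB [|i]; [exact: mA|exact: mB]. Qed.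

Lemma cons_set_rectangle A B n :
  [set w : seqspace T | A (w 0%N) /\
    [set w' : seqspace T | forall i, (i < n)%N -> B i (w' i)] (seq_shift w)] =
  [set w | forall i, (i < n.+1)%N -> cons_set A B i (w i)].
Proof.
apply/seteqP; split => w /=; first by move=> [wA wB] [|i] //; exact: wB.
move=> wAB; split; first exact: (wAB 0%N).
by move=> i im; exact: (wAB i.+1).
Qed.

(** Both sides are finite measures in [C]: the left one pushes forward by the shift the restriction
    of [gam] to first coordinates in [A], the right one is [gam] scaled by [Q A]. They agree on
    rectangles, since prepending [A] gives a rectangle with one more side. *)
Lemma product_law_head_shift (A : set T) (C : set (seqspace T)) :
  measurable A -> measurable C ->
  gam [set w | A (w 0%N) /\ C (seq_shift w)] = (Q A * gam C)%E.
Proof.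
move=> mA mC; pose r : {nonneg R} := NngNum (fine_ge0 (measure_ge0 Q A)).
have Er : (r%:num)%:E = Q A by rewrite /= fineK// fin_num_measure.
have mU : measurable ((fun w : seqspace T => w 0%N) @^-1` A).
  by rewrite -[X in measurable X]setTI; exact: measurable_coord.
pose m1 : {measure set (seqspace T) -> \bar R} :=
  measure_function_pushforward__canonical__measure_function_Measure
    (mrestr gam mU) (@measurable_seq_shift _ T).
have m1E C' : m1 C' = gam [set w | A (w 0%N) /\ C' (seq_shift w)].
  rewrite /m1/= /pushforward /mrestr; congr (gam _).
  by apply/seteqP; split => w /= [].
rewrite -m1E -Er -[RHS]/(mscale r gam C).
apply: measure_unique_rectangles => //.
  rewrite /m1/= /pushforward /mrestr preimage_setT setTI.
  by rewrite -ge0_fin_numE ?fin_num_measure.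
move=> _ [n [B [mB ->]]]; rewrite m1E cons_set_rectangle (Hgam _).
  by rewrite big_ord_recl -[RHS]/((r%:num)%:E * gam _)%E Er (Hgam _).
exact: measurable_cons_set.
Qed.

Lemma product_law_stationary : stationary gam.
Proof.
move=> C mC; have := product_law_head_shift measurableT mC.
rewrite probability_setT mul1e => <-; congr (gam _).
by apply/seteqP; split => w //= [].
Qed.

(** Independence of the first [n] coordinates from the tail; the induction peels off one coordinate
    at a time. *)
Lemma product_law_rectangle_indep n (B : nat -> set T) (C : set (seqspace T)) :
  (forall i, measurable (B i)) -> measurable C ->
  let D := [set w : seqspace T | forall i, (i < n)%N -> B i (w i)] in
  gam (D `&` iter n (@seq_shift T) @^-1` C) = (gam D * gam C)%E.
Proof.
move=> + mC; elim: n B => [|n IH] B mB /=.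
  rewrite (_ : mkset _ = setT) ?setTI ?probability_setT ?mul1e//.
  by apply/seteqP; split.
have mB' i : measurable (B i.+1) by [].
have BE : cons_set (B 0%N) (fun i => B i.+1) = B by apply/funext => -[].
have := cons_set_rectangle (B 0%N) (fun i => B i.+1) n; rewrite BE => <-.
rewrite product_law_head_shift//; last exact: (measurable_rectangle n mB').
rewrite -muleA -(IH _ mB') -product_law_head_shift//; last first.
  apply: measurableI; first exact: (measurable_rectangle n mB').
  by rewrite -[X in measurable X]setTI; exact: measurable_iter_seq_shift.
congr (gam _); apply/seteqP; split => w /=.
  by rewrite -iterS iterSr => -[[? ?] ?].
by rewrite -iterS iterSr => -[? [? ?]].
Qed.

(** A zero-one law: an invariant [C] is its own preimage under every iterated shift, hence
    independent of every rectangle. The finite measures sending [D] to the mass of [D] inside [C]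
    and to [gam C * gam D] thus coincide, and taking [D = C] shows that [gam C] equals its
    square. *)
Lemma product_law_ergodic : ergodic gam.
Proof.
move=> C mC CE.
have CEn n : iter n (@seq_shift T) @^-1` C = C.
  elim: n => // n IH; rewrite -[RHS]IH -[in RHS]CE //.
have gC0 : 0 <= fine (gam C) by rewrite fine_ge0.
pose r : {nonneg R} := NngNum gC0.
have Er : (r%:num)%:E = gam C by rewrite /= fineK// fin_num_measure.
have : gam (C `&` C) = (gam C * gam C)%E.
  rewrite -{1}Er -[LHS]/(mrestr gam mC C) -[RHS]/(mscale r gam C).
  apply: measure_unique_rectangles => //.
    by rewrite /= /mrestr setTI -ge0_fin_numE ?fin_num_measure.
  move=> _ [n [B [mB ->]]].
  rewrite -[RHS]/((r%:num)%:E * gam _)%E Er muleC.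
  rewrite -product_law_rectangle_indep// CEn setIC.
  by rewrite -[LHS]/(gam _) setIC.
rewrite setIid -Er -EFinM => -[] /eqP.
rewrite -[X in X == _]mulr1 -subr_eq0 -mulrBr mulf_eq0 subr_eq0.
by case/orP => /eqP rE; [left|right]; congr EFin.
Qed.

Lemma Rintegral_head_shift (F : T * seqspace T -> R) : bounded_measurable F ->
  \int[gam]_w F (w 0%N, seq_shift w) = \int[(Q \x gam)%E]_z F z.
Proof.
move=> bF; rewrite -(Rintegral_image_law gam measurable_head_shift bF).
apply: Rintegral_eq_law => X mX; apply/esym.
apply: (@product_measure_unique _ _ _ _ _ Q gam
  (image_law gam measurable_head_shift)) => // A C mA mC.
by rewrite -product_law_head_shift.
Qed.

End product_law.

(** * The ergodic theorem *)

Section ergodic_sums.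
Context d (T : measurableType d) (R : realType).
Variable P : probability (seqspace T) R.
Hypotheses (Pstat : stationary P) (Perg : ergodic P).
Local Notation shift := (@seq_shift T).
Implicit Types h g : seqspace T -> R.

Definition ergodic_sum (h : seqspace T -> R) (n : nat) (w : seqspace T) : R :=
  \sum_(i < n) h (iter i shift w).

Lemma ergodic_sumS h n w :
  ergodic_sum h n.+1 w = h w + ergodic_sum h n (shift w).
Proof.
rewrite /ergodic_sum big_ord_recl /=; congr (_ + _).
by apply: eq_bigr => i _; rewrite -iterS iterSr.
Qed.

Lemma bounded_measurable_iter_shift h n : bounded_measurable h ->
  bounded_measurable (fun w => h (iter n shift w)).
Proof.
by move=> bh; apply: bounded_measurable_comp bh; exact: measurable_iter_seq_shift.
Qed.

Lemma bounded_measurable_ergodic_sum h n : bounded_measurable h ->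
  bounded_measurable (ergodic_sum h n).
Proof.
move=> bh; apply: (bounded_measurable_sum _ (fun i : 'I_n => _)) => i.
exact: bounded_measurable_iter_shift.
Qed.

Lemma Rintegral_shift h : bounded_measurable h ->
  \int[P]_w h (shift w) = \int[P]_w h w.
Proof.
move=> bh; rewrite -(Rintegral_image_law P (@measurable_seq_shift _ T) bh).
by apply: Rintegral_eq_law => A mA; exact: Pstat.
Qed.

(* [max_sum g n] is the maximum of 0 and the first n partial sums of g. *)
Fixpoint max_sum (g : seqspace T -> R) (n : nat) (w : seqspace T) : R :=
  if n is m.+1 then Num.max 0 (g w + max_sum g m (shift w)) else 0.

Lemma max_sum_ge0 g n w : 0 <= max_sum g n w.
Proof. by case: n => [|n] //=; rewrite le_max lexx. Qed.

Lemma max_sum_nondecreasing g w :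
  {homo (fun n => max_sum g n w) : m n / (m <= n)%N >-> m <= n}.
Proof.
apply: (homo_leq (@lexx _ _) (@le_trans _ _)) => n.
elim: n w => [|n IH] w; first exact: max_sum_ge0.
rewrite /= ge_max le_max lexx /= le_max; apply/orP; right.
by rewrite lerD2l; exact: IH.
Qed.

Lemma ergodic_sum_le_max_sum g n w : ergodic_sum g n w <= max_sum g n w.
Proof.
elim: n w => [|n IH] w; first by rewrite /ergodic_sum big_ord0.
by rewrite ergodic_sumS /= le_max lerD2l IH orbT.
Qed.

Lemma bounded_measurable_max_sum g n : bounded_measurable g ->
  bounded_measurable (max_sum g n).
Proof.
move=> bg; elim: n => [|n IH] /=; first exact: bounded_measurable_cst.
apply: bounded_measurable_max; first exact: bounded_measurable_cst.
apply: bounded_measurableD => //; apply: bounded_measurable_comp IH.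
exact: measurable_seq_shift.
Qed.

(** The supremum of the partial sums is infinite; natural thresholds keep the set a countable
    combination of measurable sets. *)
Definition unbounded_sums (g : seqspace T -> R) : set (seqspace T) :=
  [set w | forall k : nat, exists n, k%:R < ergodic_sum g n w].

Lemma measurable_unbounded_sums g : bounded_measurable g ->
  measurable (unbounded_sums g).
Proof.
move=> bg.
rewrite (_ : unbounded_sums g = \bigcap_k \bigcup_n
    (ergodic_sum g n @^-1` `]k%:R, +oo[)); last first.
  apply/seteqP; split => w /= gw k.
    by move=> _; have [n] := gw k; exists n => //=; rewrite in_itv/= andbT.
  by have [n _ /=] := gw k I; rewrite in_itv/= andbT; exists n.
apply: bigcapT_measurable => k; apply: bigcupT_measurable => n.
rewrite -[X in measurable X]setTI.
by have [mg _] := bounded_measurable_ergodic_sum n bg; exact: mg.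
Qed.

(** Sums along [w] and along [shift w] differ by the single term [g w], which is bounded; raising
    the threshold by [N] absorbs it. *)
Lemma unbounded_sums_invariant g M : (forall w, `|g w| <= M) ->
  shift @^-1` unbounded_sums g = unbounded_sums g.
Proof.
move=> gM; have [N MN] : exists N : nat, M <= N%:R.
  by exists (Num.bound `|M|); rewrite (le_trans (ler_norm M))// ltW// archi_boundP.
apply/seteqP; split => w gw k; have [n] := gw (k + N)%N => kn.
  exists n.+1; rewrite ergodic_sumS.
  by have := gM w; rewrite ler_norml natrD in kn *; move: kn MN; lra.
(* The empty sum is 0 and cannot exceed a nonnegative threshold. *)
case: n kn => [|n]; first by rewrite /ergodic_sum big_ord0 ltNge ler0n.
rewrite ergodic_sumS natrD => kn; exists n.
by have := gM w; rewrite ler_norml; move: kn MN; lra.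
Qed.

(* [max_sum g n.+1 - max_sum g n \o shift] is [Num.max g (- max_sum g n \o shift)];
   its integral is nonnegative and it converges to [g] where the sums are
   unbounded. *)
Lemma maximal_ergodic g : bounded_measurable g -> P (unbounded_sums g) = 1%E ->
  0 <= \int[P]_w g w.
Proof.
move=> bg gP; have [mg [M gM]] := bg.
pose u n w := max_sum g n.+1 w - max_sum g n (shift w).
have bm n : bounded_measurable (fun w => max_sum g n (shift w)).
  apply: bounded_measurable_comp (bounded_measurable_max_sum n bg).
  exact: measurable_seq_shift.
have bu n : bounded_measurable (u n).
  by apply: bounded_measurableB => //; exact: bounded_measurable_max_sum.
have uE n w : u n w = Num.max (- max_sum g n (shift w)) (g w).
  by rewrite /u /= addr_maxl sub0r addrK.
(* Stationarity removes the shift under the integral, and [max_sum] is nondecreasing in [n]. *)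
have u0 n : 0 <= \int[P]_w u n w.
  rewrite RintegralB_prob//; last exact: bounded_measurable_max_sum.
  rewrite Rintegral_shift; last exact: bounded_measurable_max_sum.
  rewrite subr_ge0 le_Rintegral_prob//; [exact: bounded_measurable_max_sum..|].
  by move=> w; exact: max_sum_nondecreasing.
have ug : (fun n => \int[P]_w u n w) @ \oo --> \int[P]_w g w.
  apply: (@bounded_cvg_Rintegral _ _ _ P u g M) => //.
  - by move=> n; case: (bu n).
  - move=> n w; have := gM w; rewrite (uE n w) !ler_norml => /andP[gwM gMw].
    rewrite le_max gwM orbT ge_max gMw andbT /=.
    apply: (@le_trans _ _ 0); first by rewrite oppr_le0 max_sum_ge0.
    exact: le_trans (normr_ge0 _) (gM w).
  - have mU := measurable_unbounded_sums bg.
    exists (~` unbounded_sums g); split.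
    + exact: measurableC.
    + by rewrite probability_setC// gP subee.
    + move=> w /=; apply: contra_not => gw.
      (* By invariance the sums along [shift w] are unbounded too. Once [max_sum] there exceeds the
         bound of [g], the maximum is [g w], so the sequence is eventually constant. *)
      move: gw; rewrite -(unbounded_sums_invariant gM) => gw.
      have [n gn] := gw (Num.bound M).
      apply: cvg_near_cst; near=> m; rewrite uE.
      have nm : (n <= m)%N by near: m; exact: nbhs_infty_ge.
      apply/max_idPr; have := max_sum_nondecreasing g (shift w) nm.
      have := ergodic_sum_le_max_sum g n (shift w).
      have := gM w; rewrite ler_norml; move: gn.
      have := archi_boundP (le_trans (normr_ge0 _) (gM w)); lra.
by apply: (cvgr_to_ge ug); exact: nearW.
Unshelve. all: end_near.
Qed.

(** One-sided ergodic theorem; lower bounds come from [- h]. The set where the sums of [h - c] are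
    unbounded is invariant, so it has mass 0 or 1, and mass 1 would contradict the maximal
    inequality because [h - c] has negative mean. *)
Theorem ergodic_sum_upper h c : bounded_measurable h -> \int[P]_w h w < c ->
  {ae P, forall w, exists K, forall n, ergodic_sum h n w <= c * n%:R + K}.
Proof.
move=> bh hc; pose g w := h w - c.
have bg : bounded_measurable g.
  by apply: bounded_measurableB => //; exact: bounded_measurable_cst.
have mU := measurable_unbounded_sums bg.
exists (unbounded_sums g); split => //.
  have [_ [M gM]] := bg.
  have [//|g1] := Perg mU (unbounded_sums_invariant gM).
  have := maximal_ergodic bg g1.
  rewrite RintegralB_prob//; last exact: bounded_measurable_cst.
  by rewrite Rintegral_prob_cst subr_ge0 leNgt hc.
move=> w /=; apply: contraPP => /existsNP[k kw]; apply.
exists k%:R => n; apply: contrapT => /negP; rewrite -ltNge => ckn.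
apply: kw; exists n; rewrite /ergodic_sum sumrB sumr_const card_ord.
by rewrite -(mulr_natr c n) ltrBrDr addrC.
Qed.

End ergodic_sums.

(** * Borel subsets of Euclidean space *)

Section subset_of_rV.
Context (R : realType) (n : nat) (A : set 'rV[R]_n) (A0 : A !=set0).
Local Notation X := (borel_sub A0).

(** The sup-norm ball, written by coordinates because the order and the projection onto the box act
    coordinatewise. *)
Definition near_by (e : R) (s s' : X) : Prop :=
  forall i, `|\val s 0 i - \val s' 0 i| < e.

Lemma nbhs_borel_subP (s : X) (U : set X) :
  nbhs s U <-> exists2 e, 0 < e & forall s', near_by e s s' -> U s'.
Proof.
split=> [|[e e0 eU]].
  move=> /(@nbhs_ballP R (set_type A))[e /= e0 eU]; exists e => // s' ss'.
  by apply: eU; split => // i j; rewrite (ord1 i); exact: ss'.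
apply/(@nbhs_ballP R (set_type A)); exists e => //= s' [_ ss'].
by apply: eU => i; exact: ss'.
Qed.

Lemma cvg_borel_subP (u : nat -> X) (s : X) :
  u @ \oo --> s <->
  forall e, 0 < e -> \forall n \near \oo, near_by e s (u n).
Proof.
split=> [us e e0|us U /nbhs_borel_subP[e e0 eU]].
  by apply: us; apply/nbhs_borel_subP; exists e.
by apply: filterS (us e e0) => m; exact: eU.
Qed.

Lemma cvg_borel_sub_coord (u : nat -> X) (s : X) :
  (forall i, (fun n => \val (u n) 0 i) @ \oo --> \val s 0 i) -> u @ \oo --> s.
Proof.
move=> us; apply/cvg_borel_subP => e e0.
apply: filter_forall => i.
by have /cvgrPdist_lt/(_ e e0) := us i.
Qed.

Lemma continuous_borel_subP (g : X -> R) : continuous g <->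
  forall s e, 0 < e -> exists2 r, 0 < r &
    forall s', near_by r s s' -> `|g s - g s'| < e.
Proof.
split=> [cg s e e0|cg s].
  exact/nbhs_borel_subP/(cg s _ (nbhsx_ballx (g s) e e0)).
move=> W /nbhs_ballP[e /= e0 eW]; apply/nbhs_borel_subP.
by have [r r0 rg] := cg s e e0; exists r => // s' /rg/eW.
Qed.

(** Turns the sequential form of (A.3) into continuity for filters: if continuity fails at [s], bad
    points within [1/(m+1)] of [s] form a sequence converging to [s]. *)
Lemma sequentially_continuous (g : X -> R) :
  (forall (u : nat -> X) s, u @ \oo --> s -> (fun n => g (u n)) @ \oo --> g s) ->
  continuous g.
Proof.
move=> sg; apply/continuous_borel_subP => s e e0; apply: contrapT => H.
have {}H m : exists s', near_by m.+1%:R^-1 s s' /\ e <= `|g s - g s'|.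
  apply: contrapT => Hm; apply: H; exists m.+1%:R^-1; first by rewrite invr_gt0.
  by move=> s' ss'; rewrite ltNge; apply/negP => es'; apply: Hm; exists s'.
have [u Hu] := choice H.
have /sg : u @ \oo --> s.
  apply/cvg_borel_subP => r r0; near=> m => i.
  apply: (lt_trans ((Hu m).1 i)).
  near: m; exact: (near_infty_natSinv_lt (PosNum r0)).
move=> /cvgrPdist_lt/(_ e e0)[m _ /(_ m (leqnn m))].
by rewrite ltNge (Hu m).2.
Unshelve. all: end_near.
Qed.

Lemma near_by_norm e s s' : 0 < e ->
  near_by e s s' <-> `|\val s - \val s'| < e.
Proof.
move=> e0; have -> : `|\val s - \val s'| < e <-> ball (\val s) e (\val s').
  by rewrite mx_norm_ball.
split=> [ss'|[_ ss'] i]; last exact: ss'.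
by split => // i j; rewrite (ord1 i); exact: ss'.
Qed.

(** The function is the distance to the complement of [U], which is 1-Lipschitz by the triangle
    inequality. *)
Lemma open_borel_sub_support (U : set X) : open U ->
  exists g : X -> R, [/\ continuous g, forall s, 0 <= g s &
    forall s, U s <-> 0 < g s].
Proof.
move=> oU; have [UT|/existsNP[t0 Ut0]] := pselect (forall s, U s).
  exists (fun=> 1); split => //.
  by apply/continuous_borel_subP => s e e0; exists 1 => // s' _; rewrite subrr normr0.
pose D (s : X) := [set `|\val s - \val t| | t in ~` U].
have lbD s : lbound (D s) 0 by move=> _ [t _ <-]; exact: normr_ge0.
have D0 s : D s !=set0 by exists (`|\val s - \val t0|), t0.
have hD s t : ~ U t -> inf (D s) <= `|\val s - \val t|.
  by move=> Ut; apply: ge_inf; [exists 0|exists t].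
exists (fun s => inf (D s)); split.
  have lip s s' : inf (D s) <= `|\val s - \val s'| + inf (D s').
    rewrite -lerBlDl; apply: lb_le_inf => // _ [t Ut <-].
    rewrite lerBlDl (le_trans (hD s t Ut))//.
    by rewrite -(subrKA (\val s')) ler_normD.
  apply/continuous_borel_subP => s e e0; exists e => // s' /(near_by_norm _ _ e0).
  move=> ss'; rewrite ltr_norml; have := lip s s'; have := lip s' s.
  rewrite [in X in X -> _]distrC; move: ss'; clear; lra.
  by move=> s; exact: lb_le_inf.
move=> s; split=> [Us|]; last first.
  apply: contraPP => Us; apply/negP; rewrite -leNgt.
  by rewrite (le_trans (hD s s Us))// subrr normr0.
have /nbhs_borel_subP[e e0 eU] : nbhs s U by exact: open_nbhs_nbhs.
apply: (lt_le_trans e0); apply: lb_le_inf => // _ [t Ut <-].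
by rewrite leNgt; apply/negP => /(near_by_norm _ _ e0)/eU.
Qed.

(** A proper filter on the subtype pushes forward to one on [A]; its cluster point lies in [A] and
    therefore lifts back. *)
Lemma compact_borel_sub : compact A -> compact [set: X].
Proof.
move=> cA F FF FT.
have [|p [Ap Fp]] := cA ((fun s : X => \val s) @ F) (fmap_proper_filter _ FF).
  by apply: (@filterS _ F _ setT) => // s _; exact: (set_mem (svalP s)).
exists (exist _ p (mem_set Ap)); split => // B C FB /nbhs_borel_subP[e e0 eC].
have [||q [[b Bb <-] [_ pb]]] := Fp [set \val (b : X) | b in B] (ball p e).
- by apply: (@filterS _ F _ B) => // b Bb; exists b.
- exact: nbhsx_ballx.
by exists b; split => //; apply: eC => i; exact: pb.
Qed.

(** Heine-Cantor, with compactness as near covering for the filter of small positive radii. *)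
Lemma compact_uniformly_continuous (g : X -> R) e :
  compact [set: X] -> continuous g -> 0 < e -> exists2 r, 0 < r &
    forall s s', near_by r s s' -> `|g s - g s'| < e.
Proof.
move=> /compact_near_coveringP cX /continuous_borel_subP cg e0.
have := cX _ (0^'+ : set_system R)
  (fun r s => forall s', near_by r s s' -> `|g s - g s'| < e) _ _.
move=> [|r /= r0 rP].
  move=> s _; have [r r0 rg] := cg s (e / 2) (divr_gt0 e0 (ltr0n _ 2)).
  (* If [x] is within [r / 2] of [s] and [y] within [t < r / 2] of [x], then both lie within [r] of
     [s]. *)
  exists (near_by (r / 2) s, [set t | t < r / 2]).
    split; first by apply/nbhs_borel_subP; exists (r / 2) => //; exact: divr_gt0.
    by apply: nbhs_right_lt; exact: divr_gt0.
  move=> [x t] /= [sx tr] y xy.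
  rewrite -(subrKA (g s)) [e]splitr (le_lt_trans (ler_normD _ _))// ltrD//.
    rewrite distrC; apply: rg => i; apply: (lt_trans (sx i)).
    by rewrite ltr_pdivrMr// ltr_pMr// ltr1n.
  apply: rg => i; rewrite -(subrKA (\val x 0 i)).
  rewrite [r]splitr (le_lt_trans (ler_normD _ _))// ltrD//.
  exact: lt_trans (xy i) tr.
exists (r / 2); first exact: divr_gt0.
move=> s s'; apply: (rP (r / 2)) => //=.
  by rewrite sub0r normrN gtr0_norm ?divr_gt0// ltr_pdivrMr// ltr_pMr// ltr1n.
exact: divr_gt0.
Qed.

Lemma compact_continuous_bounded (g : X -> R) :
  compact [set: X] -> continuous g -> exists M, forall s, `|g s| <= M.
Proof.
move=> /compact_near_coveringP cX cg.
have [|M [_ MP]] := cX _ (+oo : set_system R) (fun r s => `|g s| <= r) _.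
  move=> s _; exists (g @^-1` ball (g s) 1, [set t | `|g s| + 1 <= t]).
    split; first exact: (cg s _ (nbhsx_ballx (g s) 1 ltr01)).
    exact: nbhs_pinfty_ge.
  move=> [x t] /= [sx]; apply: le_trans.
  rewrite -[g x](subrK (g s)) addrC (le_trans (ler_normD _ _))// lerD2l ltW//.
  by rewrite distrC.
exists (M + 1) => s; apply: (MP (M + 1)) => //; by rewrite ltrDl.
Qed.

Lemma continuous_measurable_borel_sub (g : X -> R) :
  continuous g -> measurable_fun setT g.
Proof.
move=> /continuousP cg; apply: (measurability _ (RGenOpens.measurableE R)).
move=> _ [_ [x [y ->] <-]]; rewrite setTI; apply: sub_sigma_algebra.
exact/cg/interval_open.
Qed.

Lemma continuous_bounded_measurable (g : X -> R) :
  compact [set: X] -> continuous g -> bounded_measurable g.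
Proof.
move=> cX cg; split; first exact: continuous_measurable_borel_sub.
exact: compact_continuous_bounded.
Qed.


Lemma continuous_measurable_borel_sub_endo (g : X -> X) :
  continuous g -> measurable_fun setT g.
Proof.
move=> cg; apply: (measurability (@open X)) => // _ [B oB <-].
by rewrite setTI; apply: sub_sigma_algebra; by move/continuousP: cg; apply.
Qed.

(** Reduces to real-valued limits: an open [U] is the set where a continuous [g] is positive, and
    [g \o z] is a limit of measurable real functions. *)
Lemma measurable_pointwise_limit d (T : measurableType d) (u : nat -> T -> X)
    (z : T -> X) : (forall n, measurable_fun setT (u n)) ->
  (forall w, (fun n => u n w) @ \oo --> z w) -> measurable_fun setT z.
Proof.
move=> mu uz; apply: (measurability (@open X)) => // _ [U oU <-]; rewrite setTI.
have [g [cg g0 Ug]] := open_borel_sub_support oU.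
have mgz : measurable_fun setT (g \o z).
  apply: (@measurable_fun_cvg _ _ _ _ (fun n => g \o u n)).
    by move=> m; apply: measurableT_comp => //; exact: continuous_measurable_borel_sub.
  by move=> w _; apply: cvg_comp (uz w) _; exact: cg.
rewrite (_ : _ @^-1` _ = (g \o z) @^-1` `]0, +oo[); last first.
  by apply/seteqP; split => w /=; rewrite in_itv/= andbT; move/Ug.
by rewrite -[X in measurable X]setTI; exact: mgz.
Qed.

(** Open sets generate and are closed under intersection, so they suffice; the indicator of an open
    set is the limit of the continuous functions [min 1 (m * g)], with [g] positive exactly on
    it. *)
Lemma eq_measure_continuous (P P' : probability X R) : compact [set: X] ->
  (forall g : X -> R, continuous g -> \int[P]_x g x = \int[P']_x g x) ->
  forall B, measurable B -> P B = P' B.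
Proof.
move=> cX PP' B mB.
apply: (measure_unique (@open X) (fun=> setT)) => //.
- by move=> U V; exact: openI.
- by move=> _; exact: openT.
- by rewrite bigcup_const.
- move=> U oU; have mU : measurable U by exact: sub_sigma_algebra.
  have [g [cg g0 Ug]] := open_borel_sub_support oU.
  pose h m s : R := Num.min 1 (m%:R * g s).
  have ch m : continuous (h m).
    apply/continuous_borel_subP => s e e0.
    (* [h m] varies at most [m] times as much as [g]; dividing by [m.+1] also covers [m = 0]. *)
    have e'0 : 0 < e / m.+1%:R by rewrite divr_gt0.
    have [r r0 rg] := (continuous_borel_subP g).1 cg s _ e'0.
    exists r => // s' /rg; rewrite ltr_pdivlMr// => gss'.
    apply: le_lt_trans gss'; rewrite /h.
    apply: (@le_trans _ _ `|m%:R * g s - m%:R * g s'|); last first.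
      by rewrite -mulrBr normrM mulrC normr_nat ler_wpM2l// ler_nat.
    have := ler_norm (m%:R * g s - m%:R * g s').
    have := ler_norm (- (m%:R * g s - m%:R * g s')); rewrite normrN.
    rewrite ler_norml; case: (leP 1 (m%:R * g s));
      by case: (leP 1 (m%:R * g s')); clear; lra.
  have h1 m s : `|h m s| <= 1.
    by rewrite ger0_norm /h ?ge_min ?lexx// le_min ler01 mulr_ge0.
  have hU s : (fun m => h m s) @ \oo --> (\1_U s : R).
    rewrite indicE; have [/set_mem Us|/negP Us] := boolP (s \in U).
      apply: cvg_near_cst; near=> m; apply/min_idPl.
      have gs := (Ug s).1 Us; rewrite -ler_pdivrMr// mul1r.
      by near: m; exact: nbhs_infty_ger.
    rewrite (_ : (fun m => _) = fun=> 0); first exact: cvg_cst.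
    apply/funext => m; rewrite /h (_ : g s = 0) ?mulr0; first exact/min_idPr.
    apply/eqP; rewrite eq_le g0 andbT leNgt; apply/negP => gs.
    by apply: Us; apply/mem_set/Ug.
  have hlim (nu : probability X R) : (fun m => \int[nu]_s h m s) @ \oo --> fine (nu U).
    have -> : fine (nu U) = \int[nu]_s \1_U s.
      by rewrite /Rintegral integral_indic// setIT.
    apply: (@bounded_cvg_Rintegral _ _ _ nu h _ 1) => //.
    + by move=> m; exact: continuous_measurable_borel_sub.
    + exact: aeW.
    + exact: bounded_measurable_indic.
  have PU : fine (P U) = fine (P' U).
    have hE : (fun m => \int[P]_s h m s) = (fun m => \int[P']_s h m s).
      by apply/funext => m; exact: PP'.
    by apply: (cvg_unique _ (hlim P)); rewrite ?hE//; exact: hlim.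
  by rewrite -[LHS]fineK ?fin_num_measure// -[RHS]fineK ?fin_num_measure// PU.
- by move=> _; rewrite -ge0_fin_numE ?fin_num_measure.
Unshelve. all: end_near.
Qed.

End subset_of_rV.

(** * Projection onto a box *)

Section clamp.
Context (R : realType).
Implicit Types a b x y : R.

Definition clamp a b x : R := Num.max a (Num.min b x).

Lemma clamp_itv a b x : a <= b -> a <= clamp a b x <= b.
Proof. by move=> ab; rewrite /clamp le_max lexx ge_max ab ge_min lexx. Qed.

Lemma clamp_id a b x : a <= x <= b -> clamp a b x = x.
Proof. by move=> /andP[ax xb]; rewrite /clamp (min_idPr xb) (max_idPr ax). Qed.

Lemma le_clamp a b x y : x <= y -> clamp a b x <= clamp a b y.
Proof.
move=> xy; rewrite /clamp ge_max le_max lexx /= le_max; apply/orP; right.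
by rewrite le_min !ge_min lexx xy orbT.
Qed.

Lemma clamp_contraction a b x y : a <= b ->
  `|clamp a b x - clamp a b y| <= `|x - y|.
Proof.
move=> ab; wlog xy : x y / x <= y => [H|].
  by have [/H//|/ltW/H] := leP x y; rewrite distrC [in X in _ <= X]distrC.
rewrite distrC [leRHS]distrC !ger0_norm ?subr_ge0 ?le_clamp//.
rewrite lerBlDr /clamp ge_max; apply/andP; split.
  rewrite (le_trans (_ : a <= Num.max a (Num.min b x)))// ?le_max ?lexx//.
  by rewrite lerDr subr_ge0.
apply: (@le_trans _ _ (y - x + Num.min b x)).
  by rewrite addr_minr le_min !ge_min subrK lexx orbT andbT lerDr subr_ge0 xy.
by rewrite lerD2l le_max lexx orbT.
Qed.

(** The obtuse-angle inequality for projection onto an interval. The second square on the left is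
    what later gives uniqueness of the nearest point. *)
Lemma clamp_nearest a b x y : a <= b -> a <= y <= b ->
  (x - clamp a b x) ^+ 2 + (clamp a b x - y) ^+ 2 <= (x - y) ^+ 2.
Proof.
move=> ab /andP[ay yb]; rewrite -subr_ge0.
have -> : (x - y) ^+ 2 - ((x - clamp a b x) ^+ 2 + (clamp a b x - y) ^+ 2) =
  2 * ((x - clamp a b x) * (clamp a b x - y)) by ring.
rewrite mulr_ge0// /clamp; case: (leP b x) => bx.
  by rewrite (max_idPr ab) mulr_ge0// subr_ge0.
case: (leP a x) => ax; first by rewrite subrr mul0r.
by rewrite mulr_le0// subr_le0// ltW.
Qed.

End clamp.

Section box.
Context (R : realType) (k : nat) (a b : 'rV[R]_k) (ab : forall i, a 0 i < b 0 i).
Local Notation S := (state ab).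

Lemma state_itv (s : S) i : a 0 i <= \val s 0 i <= b 0 i.
Proof. exact: (set_mem (svalP s)). Qed.

Lemma compact_state : compact [set: S].
Proof.
apply: compact_borel_sub.
have := @rV_compact R k (fun i => `[a 0 i, b 0 i]%classic)
  (fun i => @segment_compact R (a 0 i) (b 0 i)).
congr compact; apply/seteqP; split => s /= sab i; have := sab i => /=;
  by rewrite in_itv.
Qed.

Lemma state_eq (s s' : S) : (forall i, \val s 0 i = \val s' 0 i) -> s = s'.
Proof. by move=> ss'; apply/val_inj/rowP. Qed.

Lemma box_clamp (x : 'rV[R]_k) :
  box a b (\row_i clamp (a 0 i) (b 0 i) (x 0 i)).
Proof. by move=> i; rewrite mxE clamp_itv// ltW. Qed.

Definition clamp_state (x : 'rV[R]_k) : S :=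
  exist (fun z => z \in box a b) _ (mem_set (box_clamp x)).

Lemma clamp_stateE x i : \val (clamp_state x) 0 i = clamp (a 0 i) (b 0 i) (x 0 i).
Proof. by rewrite mxE. Qed.

(** [nearest_point] is an arbitrary choice among minimizers, so existence and uniqueness are both at
    stake. Summing [clamp_nearest] over coordinates shows that [clamp_state x] is a minimizer and
    that any other minimizer is at squared distance 0 from it. *)
Lemma nearest_point_box x : nearest_point (box_nonempty ab) x = clamp_state x.
Proof.
have enormE (y z : 'rV[R]_k) :
    (enorm (x - y) <= enorm (x - z)) =
    (\sum_i (x 0 i - y 0 i) ^+ 2 <= \sum_i (x 0 i - z 0 i) ^+ 2).
  rewrite /enorm ler_sqrt ?sumr_ge0//; last by move=> i _; exact: sqr_ge0.
  by congr (_ <= _); apply: eq_bigr => i _; rewrite !mxE.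
have sumle (s : S) : \sum_i (x 0 i - \val (clamp_state x) 0 i) ^+ 2 +
    \sum_i (\val (clamp_state x) 0 i - \val s 0 i) ^+ 2 <=
    \sum_i (x 0 i - \val s 0 i) ^+ 2.
  rewrite -big_split /=; apply: ler_sum => i _; rewrite clamp_stateE.
  exact: clamp_nearest (ltW (ab i)) (state_itv s i).
have near : nearest_point (box_nonempty ab) x \in [set s : S |
    forall s' : S, enorm (x - \val s) <= enorm (x - \val s')].
  apply/mem_set; apply: (@getPex _ [set s : S | _]); exists (clamp_state x) => s.
  rewrite enormE (le_trans _ (sumle s))// lerDl sumr_ge0// => i _; exact: sqr_ge0.
have := set_mem near (clamp_state x); rewrite enormE => xs.
have s0 : \sum_i (\val (clamp_state x) 0 i -
    \val (nearest_point (box_nonempty ab) x) 0 i) ^+ 2 = 0.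
  apply/eqP; rewrite eq_le sumr_ge0 ?andbT; last by move=> i _; exact: sqr_ge0.
  by have := le_trans (sumle _) xs; rewrite gerDl.
apply: state_eq => i; apply/eqP; rewrite eq_sym -subr_eq0 -sqrf_eq0.
apply/eqP; apply: (psumr_eq0P _ s0) => // j _; exact: sqr_ge0.
Qed.

(** The map that [perturb c psi] applies both before and after [psi]. *)
Definition translate (c : R) (s : S) : S :=
  nearest_point (box_nonempty ab) (\val s + c *: const_mx 1).

Lemma translateE c s i :
  \val (translate c s) 0 i = clamp (a 0 i) (b 0 i) (\val s 0 i + c).
Proof. by rewrite /translate nearest_point_box clamp_stateE !mxE mulr1. Qed.

Lemma translate_mono c s s' : state_le s s' -> state_le (translate c s) (translate c s').
Proof. by move=> ss' i; rewrite !translateE le_clamp// lerD2r. Qed.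

Lemma translate_near_by c e s : `|c| < e -> near_by e s (translate c s).
Proof.
move=> ce i; rewrite translateE -[X in `|X - _|](clamp_id (state_itv s i)).
rewrite (le_lt_trans _ ce)// (le_trans (clamp_contraction _ _ (ltW (ab i))))//.
by rewrite opprD addNKr normrN.
Qed.

Lemma continuous_translate c : continuous (translate c).
Proof.
move=> s U /nbhs_borel_subP[e e0 eU]; apply/nbhs_borel_subP; exists e => // s' ss'.
apply: eU => i; rewrite !translateE.
rewrite (le_lt_trans (clamp_contraction _ _ (ltW (ab i))))//.
by rewrite opprD addrACA subrr addr0.
Qed.

(* Reversing the order ([up = false]) turns lower bounds for an increasing
   function into upper bounds for its opposite; [box_top up] is the greatest
   state for [dir_le up]. *)
Definition box_top (up : bool) : S := clamp_state (if up then b else a).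

Definition dir_le (up : bool) (s s' : S) : Prop :=
  if up then state_le s s' else state_le s' s.

Lemma dir_le_top up s : dir_le up s (box_top up).
Proof.
case: up => i; rewrite /= clamp_stateE; have /andP[sa sb] := state_itv s i.
  by rewrite clamp_id// lexx (le_trans sa sb).
by rewrite clamp_id// lexx (le_trans sa sb).
Qed.

Lemma dir_le_refl up s : dir_le up s s.
Proof. by case: up => i /=. Qed.

Lemma dir_le_trans up s s' s'' : dir_le up s s' -> dir_le up s' s'' -> dir_le up s s''.
Proof.
case: up => /= ss' s's'' i; first exact: le_trans (ss' i) (s's'' i).
exact: le_trans (s's'' i) (ss' i).
Qed.

Lemma dir_decreasing_cvg up (u : nat -> S) :
  (forall n, dir_le up (u n.+1) (u n)) -> exists s : S, u @ \oo --> s.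
Proof.
move=> u_dec.
have cvgu i : exists x : R, (fun n => \val (u n) 0 i) @ \oo --> x.
  case: up u_dec => /= u_dec.
    exists (inf (range (fun n => \val (u n) 0 i))); apply: nonincreasing_cvgn.
      by apply/nonincreasing_seqP => n; exact: u_dec.
    by exists (a 0 i) => _ [n _ <-]; case/andP: (state_itv (u n) i).
  exists (sup (range (fun n => \val (u n) 0 i))); apply: nondecreasing_cvgn.
    by apply/nondecreasing_seqP => n; exact: u_dec.
  by exists (b 0 i) => _ [n _ <-]; case/andP: (state_itv (u n) i).
have [x ux] := choice cvgu.
(* [clamp_state] serves to form an element of [S]; it leaves the limit unchanged, since the bounds
   of the box pass to the limit. *)
exists (clamp_state (\row_i x i)); apply: cvg_borel_sub_coord => i.
rewrite clamp_stateE mxE clamp_id//; apply/andP; split.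
  by apply: (cvgr_to_ge (ux i)); apply: nearW => n; case/andP: (state_itv (u n) i).
by apply: (cvgr_to_le (ux i)); apply: nearW => n; case/andP: (state_itv (u n) i).
Qed.

End box.

(** * Monotone random maps *)

Lemma measurable_fun_comp2 d d1 d2 d3 (T : measurableType d)
    (T1 : measurableType d1) (T2 : measurableType d2) (T3 : measurableType d3)
    (f : T1 -> T2 -> T3) (u : T -> T1) (v : T -> T2) :
  measurable_fun [set: T1 * T2] (fun x => f x.1 x.2) ->
  measurable_fun setT u -> measurable_fun setT v ->
  measurable_fun setT (fun x => f (u x) (v x)).
Proof.
move=> mf mu mv.
exact: (measurableT_comp mf (measurable_fun_pair mu mv)).
Qed.

Section random_map.
Context (R : realType) (k : nat) (a b : 'rV[R]_k) (ab : forall i, a 0 i < b 0 i).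
Context (d : measure_display) (E : measurableType d) (Q : probability E R).
Local Notation S := (state ab).
Implicit Types (psi : S -> E -> S) (g : S -> R).

(** The Markov operator of the random map, acting on functions. *)
Definition transition psi g (s : S) : R := \int[Q]_e g (psi s e).

(** The content of (A.1)-(A.3) for one parameter, with (A.3) as the Feller property; in this form it
    passes to perturbed maps. *)
Definition regular_map psi : Prop :=
  [/\ measurable_fun [set: S * E] (fun x => psi x.1 x.2),
      forall e s s', state_le s s' -> state_le (psi s e) (psi s' e) &
      forall g, continuous g -> continuous (transition psi g)].

Lemma regular_map_dir_le psi up e s s' : regular_map psi ->
  dir_le up s s' -> dir_le up (psi s e) (psi s' e).
Proof. by case=> _ psi_mono _; case: up => /=; exact: psi_mono. Qed.

Lemma bounded_measurable_state g : continuous g -> bounded_measurable g.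
Proof. exact/continuous_bounded_measurable/compact_state. Qed.

Lemma continuous_iter_transition psi g n : regular_map psi -> continuous g ->
  continuous (iter n (transition psi) g).
Proof. by case=> _ _ feller cg; elim: n => // n IH; exact: feller. Qed.

Lemma sim_pathD psi s w n m :
  sim_path psi s w (n + m) =
  sim_path psi (sim_path psi s w n) (iter n (@seq_shift E) w) m.
Proof.
elim: m => [|m IH]; first by rewrite addn0.
by rewrite addnS /= IH seq_shift_iter.
Qed.

Lemma sim_path_dir_le psi up s s' w n : regular_map psi ->
  dir_le up s s' -> dir_le up (sim_path psi s w n) (sim_path psi s' w n).
Proof.
by move=> rpsi ss'; elim: n => //= n IH; exact: regular_map_dir_le.
Qed.

(** At each step the two maps are compared at the same state, then monotonicity of [psi'] moves to
    the larger state. *)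
Lemma sim_path_dominated psi psi' up s w n : regular_map psi' ->
  (forall s e, dir_le up (psi s e) (psi' s e)) ->
  dir_le up (sim_path psi s w n) (sim_path psi' s w n).
Proof.
move=> rpsi' psi_le; elim: n => [|n IH] /=; first exact: dir_le_refl.
by apply: dir_le_trans (psi_le _ _) _; exact: regular_map_dir_le.
Qed.

Lemma measurable_sim_path psi n : regular_map psi ->
  measurable_fun [set: S * seqspace E] (fun x => sim_path psi x.1 x.2 n).
Proof.
move=> [mpsi _ _]; elim: n => [|n IH] /=; first exact: measurable_fst.
apply: (measurable_fun_comp2 mpsi IH).
exact: (measurableT_comp (@measurable_coord _ E n) measurable_snd).
Qed.

Variables (gam : probability (seqspace E) R) (Hgam : product_law Q gam).

(** Conditioning on the first shock: the remaining shocks are independent of it and again have law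
    [gam]. *)
Lemma Rintegral_sim_path psi g s n : regular_map psi -> continuous g ->
  \int[gam]_w g (sim_path psi s w n) = iter n (transition psi) g s.
Proof.
move=> rpsi cg; have bg := bounded_measurable_state cg.
elim: n s => [|n IH] s; first by rewrite /= Rintegral_prob_cst.
pose F (z : E * seqspace E) := g (sim_path psi (psi s z.1) z.2 n).
have bF : bounded_measurable F.
  apply: bounded_measurable_comp bg.
  apply: (measurable_fun_comp2 (f := fun s w => sim_path psi s w n)
    (measurable_sim_path n rpsi)) => //.
  by case: rpsi => mpsi _ _; exact: (measurable_fun_comp2 mpsi).
transitivity (\int[gam]_w F (w 0%N, seq_shift w)).
  by apply: eq_Rintegral => w _; rewrite -add1n sim_pathD.
rewrite (Rintegral_head_shift Hgam bF) -Rintegral12_prod//.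
rewrite iterS /transition; apply: eq_Rintegral => e _. exact (IH (psi s e)).
Qed.

(* Composition of the random maps in the reverse order; it has the same law as
   [sim_path psi t w n] but, started from the top, it is monotone in [n]. *)
Fixpoint back_path psi (t : S) (n : nat) (w : seqspace E) : S :=
  if n is m.+1 then psi (back_path psi t m (seq_shift w)) (w 0%N) else t.

Lemma measurable_back_path psi t n : regular_map psi ->
  measurable_fun setT (back_path psi t n).
Proof.
move=> [mpsi _ _]; elim: n => [|n IH] /=; first exact: measurable_cst.
apply: (measurable_fun_comp2 mpsi); last exact: measurable_coord.
exact: (measurableT_comp IH (@measurable_seq_shift _ E)).
Qed.

Lemma back_path_decreasing psi up w n : regular_map psi ->
  dir_le up (back_path psi (box_top ab up) n.+1 w)
            (back_path psi (box_top ab up) n w).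
Proof.
move=> rpsi; elim: n w => [|n IH] w; first exact: dir_le_top.
exact: regular_map_dir_le (IH (seq_shift w)).
Qed.

(** The first shock is now applied last, so it is integrated first. This replaces [g] by
    [transition psi g], whence the induction over all continuous [g]. *)
Lemma Rintegral_back_path psi g t n : regular_map psi -> continuous g ->
  \int[gam]_w g (back_path psi t n w) = iter n (transition psi) g t.
Proof.
move=> rpsi; have [mpsi _ feller] := rpsi.
elim: n g => [|n IH] g cg; first by rewrite /= Rintegral_prob_cst.
have bg := bounded_measurable_state cg.
pose F (z : E * seqspace E) := g (psi (back_path psi t n z.2) z.1).
have bF : bounded_measurable F.
  apply: bounded_measurable_comp bg.
  apply: (measurable_fun_comp2 mpsi) => //.
  exact: (measurableT_comp (measurable_back_path t n rpsi) measurable_snd).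
transitivity (\int[gam]_w F (w 0%N, seq_shift w)) => //.
rewrite (Rintegral_head_shift Hgam bF) -Rintegral21_prod//.
by rewrite iterSr -IH//; exact: feller.
Qed.

Lemma iter_transition_cvg_invariant psi up : regular_map psi ->
  exists nu : probability S R, invariant_probability Q psi nu /\
    forall g, continuous g ->
      (fun n => iter n (transition psi) g (box_top ab up)) @ \oo -->
      \int[nu]_s g s.
Proof.
move=> rpsi; have [mpsi _ feller] := rpsi.
have cvg_back w : exists s : S,
    (fun n => back_path psi (box_top ab up) n w) @ \oo --> s.
  apply: (@dir_decreasing_cvg _ _ _ _ _ up) => n.
  exact: back_path_decreasing.
have [z zP] := choice cvg_back.
have mz : measurable_fun setT z.
  apply: measurable_pointwise_limit zP => n; exact: measurable_back_path.
pose nu := image_law gam mz.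
have nu_lim g : continuous g ->
    (fun n => iter n (transition psi) g (box_top ab up)) @ \oo -->
    \int[nu]_s g s.
  move=> cg; have bg := bounded_measurable_state cg.
  have [mg [M gM]] := bg.
  rewrite Rintegral_image_law//.
  under eq_fun do rewrite -Rintegral_back_path//.
  apply: (@bounded_cvg_Rintegral _ _ _ gam _ _ M) => //.
  - by move=> n; apply: measurableT_comp => //; exact: measurable_back_path.
  - apply: aeW => w; apply: cvg_comp (zP w) _; exact: cg.
  - exact: bounded_measurable_comp bg.
exists nu; split => // B mB.
(* Invariance says that [nu] is the image of [nu \x Q] under [psi]; it is enough to compare
   integrals of continuous functions. *)
rewrite (@eq_measure_continuous _ _ _ _ nu (image_law (nu \x Q)%E mpsi))//.
- rewrite image_lawE /= /product_measure1; apply: eq_integral => s _ /=.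
  by congr (Q _); apply/seteqP; split => e /=; rewrite /xsection/= ?inE.
- exact: compact_state.
- move=> g cg; have bg := bounded_measurable_state cg.
  rewrite (Rintegral_image_law (nu \x Q)%E mpsi bg).
  have bF := bounded_measurable_comp mpsi bg.
  transitivity (\int[nu]_s transition psi g s); last exact: (Rintegral12_prod nu Q bF).
  (* The limit along [transition psi g], continuous by the Feller property, is that of the sequence
     for [g] with index shifted by one. *)
  have := nu_lim _ (feller _ cg).
  under eq_fun do rewrite -iterSr.
  move=> lim; apply: (cvg_unique _ _ lim) => //.
  by have := nu_lim _ cg; rewrite -cvg_shiftS.
Qed.

Lemma iter_transition_cvg psi up (mu : probability S R) g : regular_map psi ->
  unique_invariant_probability Q psi mu -> continuous g ->
  (fun n => iter n (transition psi) g (box_top ab up)) @ \oo --> \int[mu]_s g s.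
Proof.
move=> rpsi [_ mu_unique] cg.
have [nu [nu_inv nu_lim]] := iter_transition_cvg_invariant up rpsi.
rewrite -(@Rintegral_eq_law _ _ _ nu mu); first exact: nu_lim.
exact: mu_unique.
Qed.

End random_map.

(** * Perturbed maps *)

(** Moving the index by one changes the sum by two boundary terms. The base case [m = 0] already
    moves it once, whence the factor [m.+1]. *)
Lemma sum_shift_bound (R : realType) (x : nat -> R) M m n :
  (forall j, `|x j| <= M) ->
  \sum_(i < n) x i.+1 <= \sum_(i < n) x (i + m)%N + 2 * M * m.+1%:R.
Proof.
move=> xM.
have step j : `|\sum_(i < n) x (i + j).+1 - \sum_(i < n) x (i + j)%N| <= 2 * M.
  rewrite -sumrB (eq_bigr (fun i : 'I_n => x (i.+1 + j)%N - x (i + j)%N)); last first.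
    by move=> i _; rewrite addSn.
  rewrite -(big_mkord xpredT (fun i => x (i.+1 + j)%N - x (i + j)%N)).
  rewrite (@telescope_sumr _ 0 n (fun i => x (i + j)%N))//.
  by rewrite (le_trans (ler_normB _ _))// mulr_natl mulr2n lerD.
elim: m => [|m IH].
  have -> : \sum_(i < n) x i.+1 = \sum_(i < n) x (i + 0).+1.
    by apply: eq_bigr => i _; rewrite addn0.
  by have := step 0%N; rewrite ler_norml mulr1 => /andP[_]; rewrite lerBlDl.
have -> : \sum_(i < n) x (i + m.+1)%N = \sum_(i < n) x (i + m).+1.
  by apply: eq_bigr => i _; rewrite addnS.
apply: (le_trans IH); rewrite -[m.+2%:R]natr1 mulrDr mulr1.
by have := step m; rewrite ler_norml => /andP[+ _]; clear; lra.
Qed.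

Section perturbed_map.
Context (R : realType) (k : nat) (a b : 'rV[R]_k) (ab : forall i, a 0 i < b 0 i).
Context (d : measure_display) (E : measurableType d) (Q : probability E R).
Local Notation S := (state ab).
Implicit Types (psi : S -> E -> S) (g : S -> R).

Lemma transition_perturb psi c g s :
  transition Q (perturb c psi) g s =
  transition Q psi (fun s' => g (translate c s')) (translate c s).
Proof. by []. Qed.

Lemma regular_map_perturb psi c : regular_map Q psi -> regular_map Q (perturb c psi).
Proof.
move=> [mpsi psi_mono feller]; split.
- have mt := continuous_measurable_borel_sub_endo (@continuous_translate _ _ _ _ ab c).
  have mpsi' : measurable_fun [set: S * E] (fun x => psi (translate c x.1) x.2).
    apply: (measurable_fun_comp2 mpsi) => //.
    exact: (measurableT_comp mt measurable_fst).
  exact: (measurableT_comp mt mpsi').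
- move=> e s s' ss'; apply: translate_mono; apply: psi_mono; exact: translate_mono.
- move=> g cg s.
  apply: (@continuous_comp _ _ _ (translate c)
    (transition Q psi (fun s' => g (translate c s')))).
    exact: continuous_translate.
  apply: feller => s'; apply: (@continuous_comp _ _ _ (translate c) g).
    exact: continuous_translate.
  exact: cg.
Qed.

Lemma bounded_measurable_random_map psi g s : regular_map Q psi -> continuous g ->
  bounded_measurable (fun e => g (psi s e)).
Proof.
move=> [mpsi _ _] cg; apply: bounded_measurable_comp (bounded_measurable_state cg).
exact: (measurable_fun_comp2 mpsi).
Qed.

Lemma transition_close psi g g' s e : regular_map Q psi ->
  continuous g -> continuous g' -> (forall s, `|g s - g' s| <= e) ->
  `|transition Q psi g s - transition Q psi g' s| <= e.
Proof.
move=> rpsi cg cg' gg'.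
have bg := bounded_measurable_random_map s rpsi cg.
have bg' := bounded_measurable_random_map s rpsi cg'.
rewrite /transition -RintegralB_prob//; apply: norm_Rintegral_le => //.
exact: bounded_measurableB.
Qed.

(** The outer translation changes the function and the inner one the state; uniform continuity of
    [g] and of [transition Q psi g] bounds each error by [e / 2]. *)
Lemma transition_perturb_close psi g e : regular_map Q psi -> continuous g -> 0 < e ->
  exists2 r, 0 < r & forall c, `|c| < r -> forall s,
    `|transition Q (perturb c psi) g s - transition Q psi g s| <= e.
Proof.
move=> rpsi cg e0; have e20 : 0 < e / 2 by exact: divr_gt0.
have [_ _ feller] := rpsi.
have cS := @compact_state _ _ _ _ ab.
have [r1 r10 gr1] := compact_uniformly_continuous cS cg e20.
have [r2 r20 gr2] := compact_uniformly_continuous cS (feller _ cg) e20.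
exists (Num.min r1 r2); first by rewrite lt_min r10.
move=> c; rewrite lt_min => /andP[cr1 cr2] s.
rewrite transition_perturb -(subrKA (transition Q psi g (translate c s))).
rewrite [e]splitr (le_trans (ler_normD _ _))// lerD//; last first.
  by rewrite distrC ltW// gr2//; exact: translate_near_by.
apply: transition_close => //.
  move=> s'; apply: (@continuous_comp _ _ _ (translate c) g).
    exact: continuous_translate.
  exact: cg.
by move=> s'; rewrite distrC ltW// gr1//; exact: translate_near_by.
Qed.

(** The intermediate term applies the perturbed operator once to the unperturbed iterate. Operators
    do not increase the sup distance, so the induction hypothesis bounds one half and the one-step
    estimate the other. *)
Lemma iter_transition_perturb_close psi g n e :
  regular_map Q psi -> continuous g -> 0 < e ->
  exists2 r, 0 < r & forall c, `|c| < r -> forall s,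
    `|iter n (transition Q (perturb c psi)) g s - iter n (transition Q psi) g s| <= e.
Proof.
move=> rpsi cg; elim: n e => [|n IH] e e0.
  by exists 1 => // c _ s; rewrite subrr normr0 ltW.
have e20 : 0 < e / 2 by exact: divr_gt0.
have [r1 r10 gr1] := IH _ e20.
have cn := continuous_iter_transition (n := n) rpsi cg.
have [r2 r20 gr2] := transition_perturb_close rpsi cn e20.
exists (Num.min r1 r2); first by rewrite lt_min r10.
move=> c; rewrite lt_min => /andP[cr1 cr2] s.
rewrite !iterS.
rewrite -(subrKA (transition Q (perturb c psi) (iter n (transition Q psi) g) s)).
rewrite [e]splitr (le_trans (ler_normD _ _))// lerD//; last exact: gr2.
have rc := regular_map_perturb c rpsi.
apply: transition_close => //; first exact: continuous_iter_transition.
by move=> s'; exact: gr1.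
Qed.

Variables (gam : probability (seqspace E) R) (Hgam : product_law Q gam).

(* From any state, the last [m] steps of a dominated path stay below [m] steps
   of the perturbed map started from the top, and these values form a stationary
   ergodic sequence; its mean tends to [\int[mu]_s h s] as [m] grows and [c]
   tends to 0. *)
Lemma sim_sum_upper psi up (mu : probability S R) (h : S -> R) e :
  regular_map Q psi -> unique_invariant_probability Q psi mu ->
  continuous h -> (forall s s', dir_le up s s' -> h s <= h s') -> 0 < e ->
  exists2 r, 0 < r & forall c, `|c| < r -> {ae gam, forall w, exists K,
    forall psi', (forall s e, dir_le up (psi' s e) (perturb c psi s e)) ->
    forall s0 n, \sum_(i < n) h (sim_path psi' s0 w i.+1) <=
      (\int[mu]_s h s + e) * n%:R + K}.
Proof.
move=> rpsi mu_inv ch h_mono e0; have e20 : 0 < e / 2 by exact: divr_gt0.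
have bh := bounded_measurable_state ch; have [_ [M hM]] := bh.
have [m hm] : exists m,
    iter m (transition Q psi) h (box_top ab up) < \int[mu]_s h s + e / 2.
  have /cvgrPdist_lt/(_ _ e20)[m _ /(_ m (leqnn m))] :=
    iter_transition_cvg Hgam up rpsi mu_inv ch.
  by rewrite distrC ltr_norml ltrBlDl => /andP[_]; exists m.
have [r r0 rm] := iter_transition_perturb_close m rpsi ch e20.
exists r => // c /rm {}rm; have rc := regular_map_perturb c rpsi.
pose H w := h (sim_path (perturb c psi) (box_top ab up) w m).
have bH : bounded_measurable H.
  apply: bounded_measurable_comp bh.
  exact: (measurable_fun_comp2 (f := fun s w => sim_path (perturb c psi) s w m)
    (measurable_sim_path m rc)).
have Hlt : \int[gam]_w H w < \int[mu]_s h s + e.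
  rewrite (Rintegral_sim_path Hgam _ _ rc ch).
  have := rm (box_top ab up); rewrite ler_norml => /andP[_].
  by move: hm; clear; lra.
have := ergodic_sum_upper (product_law_stationary Hgam) (product_law_ergodic Hgam) bH Hlt.
(* The first [K] comes from the ergodic theorem, the added term from shifting the summation index by
   [m]. *)
apply: filterS => w [K HK]; exists (K + 2 * M * m.+1%:R) => psi' psi'_le s0 n.
apply: (le_trans (sum_shift_bound m n (x := fun j => h (sim_path psi' s0 w j)) _)).
  by move=> j; exact: hM.
rewrite addrA lerD2r; apply: le_trans (HK n); apply: ler_sum => i _.
apply: h_mono; rewrite sim_pathD.
apply: dir_le_trans (sim_path_dominated _ _ _ rc psi'_le) _.
by apply: (sim_path_dir_le _ _ rc); exact: dir_le_top.
Qed.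

End perturbed_map.

(** * Consistency *)

Lemma ae_fst d1 d2 (T1 : measurableType d1) (T2 : measurableType d2)
    (R : realType) (P1 : probability T1 R) (P2 : probability T2 R)
    (A : T1 -> Prop) :
  {ae P1, forall x, A x} -> {ae (P1 \x P2)%E, forall z, A z.1}.
Proof.
move=> [N [mN N0 AN]]; exists (N `*` setT); split.
- exact: measurableX.
- by rewrite product_measure1E// -[RHS](mul0e (P2 setT)); congr (_ * _)%E.
- by move=> [x y] /= Ax; split => //; exact: AN.
Qed.

Lemma ae_snd d1 d2 (T1 : measurableType d1) (T2 : measurableType d2)
    (R : realType) (P1 : probability T1 R) (P2 : probability T2 R)
    (A : T2 -> Prop) :
  {ae P2, forall x, A x} -> {ae (P1 \x P2)%E, forall z, A z.2}.
Proof.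
move=> [N [mN N0 AN]]; exists (setT `*` N); split.
- exact: measurableX.
- by rewrite product_measure1E// -[RHS](mule0 (P1 setT)); congr (_ * _)%E.
- by move=> [x y] /= Ax; split => //; exact: AN.
Qed.

Lemma uniform_cvg_near (T : choiceType) (R : realType) (u : nat -> T -> R)
    (g : T -> R) e :
  {uniform, u @ \oo --> g} -> 0 < e ->
  \forall n \near \oo, forall x, `|g x - u n x| < e.
Proof.
move=> ug e0.
have : nbhs (g : {uniform T -> R}) [set h | forall x, `|g x - h x| < e].
  apply/uniform_nbhs; exists [set xy | ball xy.1 e xy.2]; split.
    exact: entourage_ball (PosNum e0).
  by move=> h hx x; exact: hx.
by move/ug.
Qed.

Lemma mean_le_near (R : realType) (e K : R) : 0 < e ->
  \forall n \near \oo, (0 < n)%N /\ K < e * n%:R.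
Proof.
move=> e0; near=> n; split; first by near: n; exact: nbhs_infty_gt.
rewrite mulrC -ltr_pdivrMr//; near: n; exact: nbhs_infty_gtr.
Unshelve. all: end_near.
Qed.

(** One [e] is the excess slope of the bounds, the other absorbs the constant [K]. *)
Lemma sum_mean_close (R : realType) (x : nat -> R) (m e K : R) (n : nat) :
  (0 < n)%N -> K < e * n%:R ->
  \sum_(i < n) x i <= (m + e) * n%:R + K ->
  - \sum_(i < n) x i <= (- m + e) * n%:R + K ->
  `|n%:R^-1 * \sum_(i < n) x i - m| < 2 * e.
Proof.
move=> n0 Kn xle xge; have n0' : 0 < n%:R :> R by rewrite ltr0n.
rewrite ltr_norml ltrBlDr ltrBrDr [_^-1 * _]mulrC ltr_pdivlMr// ltr_pdivrMr//.
move: xle xge Kn; rewrite !mulrDl !mulNr; clear; lra.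
Qed.

(** The limit objectives are [4 * e] apart. Each side spends one [e] on replacing means by their
    limits and one on replacing [G] by the sample objective. *)
Lemma approx_gap (R : realType) (m e g1 g2 n1 n2 : R) :
  `|g1 - (m + 4 * e)| < e -> `|g2 - m| < e ->
  `|g1 - n1| < e -> `|g2 - n2| < e -> n1 <= n2 -> False.
Proof. by rewrite !ltr_norml; lra. Qed.

(** * Simulated means, uniformly near a parameter *)

Section estimation.
Context (R : realType) (k l p : nat)
  (a b : 'rV[R]_k) (ab : forall i, a 0 i < b 0 i)
  (d : measure_display) (E : measurableType d) (Q : probability E R)
  (gamma : probability (seqspace E) R) (Hgamma : product_law Q gamma)
  (Theta : set 'rV[R]_l) (Theta0 : Theta !=set0)
  (phi : borel_sub Theta0 -> state ab -> E -> state ab).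
Hypothesis A1 : measurable_fun [set: state ab * E * borel_sub Theta0]
  (fun x => phi x.2 x.1.1 x.1.2).
Hypothesis A2 : forall theta e (s s' : state ab),
  state_le s s' -> state_le (phi theta s e) (phi theta s' e).
Hypothesis A3 : forall theta (g : state ab -> R), continuous g ->
  forall (sj : nat -> state ab) (s : state ab), sj @ \oo --> s ->
  (fun j => \int[Q]_e g (phi theta (sj j) e)) @ \oo -->
  \int[Q]_e g (phi theta s e).
Hypothesis A4 : forall (theta : borel_sub Theta0) (kappa : R), 0 < kappa ->
  exists V : set (borel_sub Theta0),
    [/\ open V, V theta &
     forall theta', V theta' ->
       shock_le (phi theta') (perturb kappa (phi theta)) /\
       shock_le (perturb (- kappa) (phi theta)) (phi theta')].
Variable mu : borel_sub Theta0 -> probability (state ab) R.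
Hypothesis A5 : forall theta,
  unique_invariant_probability Q (phi theta) (mu theta).

Lemma regular_model theta : regular_map Q (phi theta).
Proof.
split; last 2 first.
- by move=> e s s'; exact: A2.
- by move=> g cg; apply: sequentially_continuous => u s us; exact: A3.
have mtheta : measurable_fun [set: state ab * E] (fun x => (x, theta)).
  exact: pair2_measurable.
exact: (measurableT_comp A1 mtheta).
Qed.

(** (A.4) squeezes all maps with parameter in [V] between two perturbations of the map at [theta],
    so one null set and one [K] serve every [theta'] in [V] and every [s0]. *)
Lemma sim_sum_upper_near up theta (h : state ab -> R) e :
  continuous h -> (forall s s', dir_le up s s' -> h s <= h s') -> 0 < e ->
  exists2 V, nbhs theta V & {ae gamma, forall w, exists K,
    forall theta', V theta' -> forall s0 n,
    \sum_(i < n) h (sim_path (phi theta') s0 w i.+1) <=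
      (\int[mu theta]_s h s + e) * n%:R + K}.
Proof.
move=> ch h_mono e0.
have [r r0 H] := sim_sum_upper Hgamma (regular_model theta) (A5 theta) ch h_mono e0.
have r20 : 0 < r / 2 by exact: divr_gt0.
have [V [oV Vtheta Vphi]] := A4 theta r20.
exists V; first exact: open_nbhs_nbhs.
have cr : `|if up then r / 2 else - (r / 2)| < r.
  have -> : `|if up then r / 2 else - (r / 2)| = r / 2.
    by case: up {h_mono H}; rewrite ?normrN gtr0_norm.
  by rewrite ltr_pdivrMr// ltr_pMr// ltr1n.
apply: filterS (H _ cr) => w [K HK]; exists K => theta' /Vphi[Vup Vdown].
by apply: HK => s e'; case: up {h_mono H cr} => /=; [exact: Vup|exact: Vdown].
Qed.

Variables (f : state ab -> 'rV[R]_p) (cf : continuous f).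
Hypothesis mf : forall s s' : state ab, state_le s s' -> vle (f s) (f s').

Lemma continuous_moment j : continuous (fun s => f s 0 j).
Proof.
move=> s; apply: (@continuous_comp _ _ _ f (fun v : 'rV[R]_p => v 0 j)).
  exact: cf.
exact: coord_continuous.
Qed.

Lemma bounded_measurable_moment j : bounded_measurable (fun s => f s 0 j).
Proof. by apply: bounded_measurable_state; exact: continuous_moment. Qed.

(** The upper bound for a coordinate of [f] in the given order, and the one for its opposite in the
    reversed order, enclose the mean. *)
Lemma sim_mean_near_coord theta j e : 0 < e ->
  exists2 V, nbhs theta V & {ae gamma, forall w, \forall T \near \oo,
    forall theta', V theta' -> forall s0,
    `|sim_mean f (phi theta') s0 w T 0 j - vmean (mu theta) f 0 j| < e}.
Proof.
move=> e0; have e20 : 0 < e / 2 by exact: divr_gt0.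
have cfj := continuous_moment (j := j).
have cNfj : continuous (fun s => - f s 0 j).
  move=> s; apply: (@continuous_comp _ _ _ (fun s => f s 0 j) -%R); first exact: cfj.
  exact: opp_continuous.
have [V1 nV1 H1] := @sim_sum_upper_near true theta _ _ cfj (fun s s' ss' => mf ss' j) e20.
have [|V2 nV2 H2] := @sim_sum_upper_near false theta _ _ cNfj _ e20.
  by move=> s s' ss'; rewrite lerN2; exact: mf.
exists (V1 `&` V2); first exact: filterI.
apply: filterS2 H1 H2 => w [K1 H1] [K2 H2]; near=> T => theta' [V1t V2t] s0.
have [T0 KT] : (0 < T)%N /\ Num.max K1 K2 < e / 2 * T%:R.
  by near: T; exact: mean_le_near.
have -> : sim_mean f (phi theta') s0 w T 0 j =
    T%:R^-1 * \sum_(i < T) f (sim_path (phi theta') s0 w i.+1) 0 j.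
  by rewrite /sim_mean mxE summxE big_add1 /= big_mkord.
rewrite mxE [e](_ : _ = 2 * (e / 2)); last by rewrite mulrC divfK.
apply: (sum_mean_close (K := Num.max K1 K2)
  (x := fun i => f (sim_path (phi theta') s0 w i.+1) 0 j)) => //.
  by apply: (le_trans (H1 _ V1t s0 T)); rewrite lerD2l le_max lexx.
rewrite -sumrN -RintegralN_prob; last exact: bounded_measurable_moment.
by apply: (le_trans (H2 _ V2t s0 T)); rewrite lerD2l le_max lexx orbT.
Unshelve. all: end_near.
Qed.

Lemma sim_mean_near theta e : 0 < e ->
  exists2 V, nbhs theta V & {ae gamma, forall w, \forall T \near \oo,
    forall theta', V theta' -> forall s0 j,
    `|sim_mean f (phi theta') s0 w T 0 j - vmean (mu theta) f 0 j| < e}.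
Proof.
move=> e0; have H j := sim_mean_near_coord theta j e0.
have [V HV] : exists V : 'I_p -> set (borel_sub Theta0), forall j,
  nbhs theta (V j) /\ {ae gamma, forall w, \forall T \near \oo,
    forall theta', V j theta' -> forall s0,
    `|sim_mean f (phi theta') s0 w T 0 j - vmean (mu theta) f 0 j| < e}.
  have H' j : exists V, nbhs theta V /\ {ae gamma, forall w, \forall T \near \oo,
      forall theta', V theta' -> forall s0,
      `|sim_mean f (phi theta') s0 w T 0 j - vmean (mu theta) f 0 j| < e}.
    by have [V] := H j; exists V.
  by have [V HV] := choice H'; exists V.
exists [set theta' | forall j, V j theta'].
  apply: (@filter_forall _ _ (fun j => V j) (nbhs theta) (nbhs_filter theta)) => j.
  by case: (HV j).
have : {ae gamma, forall w, forall j, \forall T \near \oo,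
    forall theta', V j theta' -> forall s0,
    `|sim_mean f (phi theta') s0 w T 0 j - vmean (mu theta) f 0 j| < e}.
  by apply: filter_forall => j; case: (HV j).
apply: filterS => w Hw.
have : \forall T \near \oo, forall j, forall theta', V j theta' -> forall s0,
    `|sim_mean f (phi theta') s0 w T 0 j - vmean (mu theta) f 0 j| < e.
  exact: filter_forall.
by apply: filterS => T HT theta' Vt s0 j; exact: HT.
Qed.

(** * Sample means of the data *)

Variables (gammat : probability (seqspace (state ab)) R).
Hypotheses (Hstat : stationary gammat) (Herg : ergodic gammat).
Variable fbar : 'rV[R]_p.
Hypothesis Hfbar :
  fbar = vmean gammat (fun st : seqspace (state ab) => f (st 0%N)).

Lemma data_mean_near e : 0 < e ->
  {ae gammat, forall st, \forall N \near \oo, forall j,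
    `|data_mean f st N 0 j - fbar 0 j| < e}.
Proof.
move=> e0; have e20 : 0 < e / 2 by exact: divr_gt0.
suff H j : {ae gammat, forall st, \forall N \near \oo,
    `|data_mean f st N 0 j - fbar 0 j| < e}.
  have : {ae gammat, forall st, forall j, \forall N \near \oo,
      `|data_mean f st N 0 j - fbar 0 j| < e} by exact: filter_forall.
  by apply: filterS => st Hst; exact: filter_forall.
pose h (st : seqspace (state ab)) := f (st 0%N) 0 j.
have bh : bounded_measurable h.
  apply: bounded_measurable_comp (bounded_measurable_moment j).
  exact: measurable_coord.
have hE st n : ergodic_sum h n st = \sum_(i < n) f (st i) 0 j.
  by apply: eq_bigr => i _; rewrite /h seq_shift_iter addn0.
have H1 := ergodic_sum_upper Hstat Herg bh (c := \int[gammat]_st h st + e / 2) _.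
have H2 := ergodic_sum_upper Hstat Herg (bounded_measurableN bh)
  (c := - (\int[gammat]_st h st) + e / 2) _.
have {}H1 := H1 (ltr_pwDr e20 (lexx _)).
have {}H2 : {ae gammat, forall st, exists K, forall n,
    ergodic_sum (fun st => - h st) n st <= (- (\int[gammat]_st h st) + e / 2) * n%:R + K}.
  by apply: H2; rewrite RintegralN_prob// ltrDl.
apply: filterS2 H1 H2 => st [K1 H1] [K2 H2]; near=> N.
have [N0 KN] : (0 < N)%N /\ Num.max K1 K2 < e / 2 * N%:R.
  by near: N; exact: mean_le_near.
rewrite /data_mean mxE summxE big_mkord Hfbar mxE.
rewrite [e](_ : _ = 2 * (e / 2)); last by rewrite mulrC divfK.
apply: (sum_mean_close (K := Num.max K1 K2) (x := fun i => f (st i) 0 j)) => //.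
  by rewrite -hE (le_trans (H1 N))// lerD2l le_max lexx.
rewrite -hE -sumrN (le_trans (H2 N))// lerD2l le_max lexx orbT//.
Unshelve. all: end_near.
Qed.

(** * Objectives and convergence of the estimator *)

Variables (G : 'rV[R]_p * 'rV[R]_p -> R) (cG : continuous G).
Variable theta0 : borel_sub Theta0.
Hypothesis Htheta0 :
  unique (minimizer (fun theta => G (vmean (mu theta) f, fbar))) theta0.
Variables (GN : nat -> seqspace E * seqspace (state ab) ->
                'rV[R]_p * 'rV[R]_p -> R)
  (tau : nat -> seqspace E * seqspace (state ab) -> nat)
  (thetah : nat -> state ab * (seqspace E * seqspace (state ab)) ->
            borel_sub Theta0).
Local Notation lambda := (gamma \x gammat)%E.
Hypothesis HGN : \forall z \ae lambda, {uniform, (fun N => GN N z) @ \oo --> G}.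
Hypothesis Htau : \forall z \ae lambda, (fun N => tau N z) @ \oo --> \oo.
Hypothesis SME : forall N, (0 < N)%N -> \forall z \ae lambda,
  forall s0 : state ab,
    attains_inf
      (fun theta =>
         GN N z (sim_mean f (phi theta) s0 z.1 (tau N z),
                 data_mean f z.2 N))
      (thetah N (s0, z)).

Lemma objective_near (x y : 'rV[R]_p) e : 0 < e -> exists2 r, 0 < r &
  forall x' y' : 'rV[R]_p, (forall j, `|x' 0 j - x 0 j| < r) ->
    (forall j, `|y' 0 j - y 0 j| < r) -> `|G (x', y') - G (x, y)| < e.
Proof.
move=> e0; have := @cG (x, y) _ (nbhsx_ballx (G (x, y)) e e0).
move=> [[A B] /= [/nbhs_ballP[r1 /= r10 rA] /nbhs_ballP[r2 /= r20 rB] AB]].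
exists (Num.min r1 r2); first by rewrite lt_min r10.
move=> x' y' xx' yy'; rewrite distrC; apply: AB; split => /=.
  apply: rA; split => // i j; rewrite (ord1 i) /ball/= distrC (lt_le_trans (xx' j))//.
  by rewrite ge_min lexx.
apply: rB; split => // i j; rewrite (ord1 i) /ball/= distrC (lt_le_trans (yy' j))//.
by rewrite ge_min lexx orbT.
Qed.

Lemma attains_inf_le (T : Type) (h : T -> R) x y : attains_inf h x -> h x <= h y.
Proof.
by rewrite /attains_inf -lee_fin => ->; apply: ereal_inf_lbound; exists y.
Qed.

(** Uniqueness of the minimizer leaves a positive gap between the objectives at [theta] and
    [theta0]. It persists for the sample objective, uniformly near [theta], so an estimate there
    would do worse than [theta0]. *)
Lemma estimator_avoids theta : theta <> theta0 ->
  exists2 V, nbhs theta V & {ae lambda, forall z, \forall N \near \oo,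
    forall s0, ~ V (thetah N (s0, z))}.
Proof.
move=> theta_neq; pose m t := G (vmean (mu t) f, fbar).
have m_lt : m theta0 < m theta.
  rewrite ltNge; apply/negP => mle; apply/theta_neq/esym/Htheta0.2 => t.
  exact: le_trans mle (Htheta0.1 t).
pose e := (m theta - m theta0) / 4.
have e0 : 0 < e by rewrite divr_gt0// subr_gt0.
have [r1 r10 G1] := objective_near (vmean (mu theta) f) fbar e0.
have [r2 r20 G2] := objective_near (vmean (mu theta0) f) fbar e0.
have [V nV HV] := sim_mean_near theta r10.
have [W nW HW] := sim_mean_near theta0 r20.
have r0 : 0 < Num.min r1 r2 by rewrite lt_min r10.
exists V => //.
pose mean (z : seqspace E * seqspace (state ab)) t s0 N :=
  (sim_mean f (phi t) s0 z.1 (tau N z), data_mean f z.2 N).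
have SME' : {ae lambda, forall z, forall N s0 t,
    GN N.+1 z (mean z (thetah N.+1 (s0, z)) s0 N.+1) <=
    GN N.+1 z (mean z t s0 N.+1)}.
  (* The estimator is constrained only for positive [N], hence the index [N.+1]; countably many null
     sets are merged. *)
  apply: ae_foralln => N; apply: filterS (SME (ltn0Sn N)) => z Hz s0 t.
  exact: (attains_inf_le t (Hz s0)).
have HD := ae_snd gamma (data_mean_near r0).
have HV' := ae_fst gammat HV; have HW' := ae_fst gammat HW.
near=> z.
have zV : \forall T \near \oo, forall theta', V theta' -> forall s0 j,
  `|sim_mean f (phi theta') s0 z.1 T 0 j - vmean (mu theta) f 0 j| < r1 by near: z.
have zW : \forall T \near \oo, forall theta', W theta' -> forall s0 j,
  `|sim_mean f (phi theta') s0 z.1 T 0 j - vmean (mu theta0) f 0 j| < r2 by near: z.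
have zD : \forall N \near \oo, forall j,
  `|data_mean f z.2 N 0 j - fbar 0 j| < Num.min r1 r2 by near: z.
have ztau : (fun N => tau N z) @ \oo --> \oo by near: z.
have zG : {uniform, (fun N => GN N z) @ \oo --> G} by near: z.
have zS : forall N s0 t,
    GN N.+1 z (mean z (thetah N.+1 (s0, z)) s0 N.+1) <=
    GN N.+1 z (mean z t s0 N.+1).
  by near: z.
(* As [tau N z] tends to infinity, what holds for all large [T] holds at [T = tau N z] for all large
   [N]. *)
have NV := ztau _ zV; have NW := ztau _ zW.
have NG := uniform_cvg_near zG e0.
near=> N => s0 Vt.
have D1 j : `|data_mean f z.2 N 0 j - fbar 0 j| < r1.
  have : forall j, `|data_mean f z.2 N 0 j - fbar 0 j| < Num.min r1 r2 by near: N.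
  by move/(_ j); rewrite lt_min => /andP[].
have D2 j : `|data_mean f z.2 N 0 j - fbar 0 j| < r2.
  have : forall j, `|data_mean f z.2 N 0 j - fbar 0 j| < Num.min r1 r2 by near: N.
  by move/(_ j); rewrite lt_min => /andP[].
have V1 : forall theta', V theta' -> forall s0 j,
    `|sim_mean f (phi theta') s0 z.1 (tau N z) 0 j - vmean (mu theta) f 0 j| < r1.
  by near: N.
have W1 : forall theta', W theta' -> forall s0 j,
    `|sim_mean f (phi theta') s0 z.1 (tau N z) 0 j - vmean (mu theta0) f 0 j| < r2.
  by near: N.
have N1 : forall x, `|G x - GN N z x| < e by near: N.
have N0 : (0 < N)%N by near: N; exact: nbhs_infty_gt.
have {}zS := zS N.-1 s0 theta0; rewrite prednK// in zS.
apply: (approx_gap (m := m theta0) _ _ (N1 _) (N1 _) zS).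
  rewrite (_ : m theta0 + 4 * e = m theta); first exact: G1 (V1 _ Vt s0) D1.
  by rewrite /e mulrC divfK// subrKC.
exact: G2 (W1 _ (nbhs_singleton nW) s0) D2.
Unshelve. all: end_near.
Qed.


(* Compactness is used through near coverings, for the filter of the sets of
   pairs (z, N) that contain, for almost every z, all large N. *)
Lemma estimator_near r : compact Theta -> 0 < r ->
  {ae lambda, forall z, \forall N \near \oo, forall s0,
    near_by r theta0 (thetah N (s0, z))}.
Proof.
move=> cTheta r0.
have /compact_near_coveringP cX := compact_borel_sub (A0 := Theta0) cTheta.
pose Z := (seqspace E * seqspace (state ab))%type.
pose F : set_system (Z * nat) := [set B | {ae lambda, forall z,
  \forall N \near \oo, B (z, N)}].
have FF : Filter F.
  split.
  - by apply: aeW => z; exact: nearW.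
  - move=> B C FB FC.
    have {}FB : {ae lambda, forall z, \forall N \near \oo, B (z, N)} by exact: FB.
    have {}FC : {ae lambda, forall z, \forall N \near \oo, C (z, N)} by exact: FC.
    apply: filterS2 FB FC => z zB zC.
    exact: filterS2 zB zC.
  - move=> B C BC FB.
    have {}FB : {ae lambda, forall z, \forall N \near \oo, B (z, N)} by exact: FB.
    apply: filterS FB => z; apply: filterS => N; exact: BC.
have cover theta : [set: borel_sub Theta0] theta ->
    \forall x' \near theta & i \near F, forall s0,
      thetah i.2 (s0, i.1) = x' -> near_by r theta0 x'.
  (* At [theta0] the ball of radius [r] gives the claim; elsewhere a neighbourhood that the
     estimator eventually avoids makes it vacuous. *)
  move=> _; have [->|/eqP theta_neq] := eqVneq theta theta0.
    exists (near_by r theta0, setT); last by move=> [x i] [/= + _] s0 _.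
    split; first by apply/nbhs_borel_subP; exists r.
    exact: filterT.
  have [V nV HV] := estimator_avoids theta_neq.
  exists (V, [set i | forall s0, ~ V (thetah i.2 (s0, i.1))]); first by split.
  by move=> [x i] [/= Vx iV] s0 ix; case: (iV s0); rewrite ix.
have H : {ae lambda, forall z, \forall N \near \oo, forall theta,
    [set: borel_sub Theta0] theta ->
    forall s0, thetah N (s0, z) = theta -> near_by r theta0 theta}.
  exact: (cX _ F (fun i theta => forall s0, thetah i.2 (s0, i.1) = theta ->
    near_by r theta0 theta) FF cover).
apply: filterS H => z; apply: filterS => N H s0.
exact: (H (thetah N (s0, z)) I s0).
Qed.

(** The radii [1/(m+1)] suffice, so a countable union of null sets gives one exceptional set for all
    radii and all [s0]. *)
Lemma estimator_cvg : compact Theta -> \forall z \ae lambda,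
  forall s0 : state ab, (fun N => thetah N (s0, z)) @ \oo --> theta0.
Proof.
move=> cTheta.
have : {ae lambda, forall z, forall m, \forall N \near \oo, forall s0,
    near_by m.+1%:R^-1 theta0 (thetah N (s0, z))}.
  by apply: ae_foralln => m; apply: estimator_near => //; rewrite invr_gt0.
apply: filterS => z Hz s0; apply/cvg_borel_subP => e e0.
have [m _ /(_ m (leqnn m)) me] := near_infty_natSinv_lt (PosNum e0).
by apply: filterS (Hz m) => N HN i; exact: lt_trans (HN s0 i) me.
Qed.

End estimation.

Theorem theorem4p4
  (R : realType) (k l p : nat)
  (* state space S *)
  (a b : 'rV[R]_k) (ab : forall i, a 0 i < b 0 i)
  (* shocks *)
  (d : measure_display) (E : measurableType d) (Q : probability E R)
  (gamma : probability (seqspace E) R) (Hgamma : product_law Q gamma)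
  (* parameter space *)
  (Theta : set 'rV[R]_l) (Theta0 : Theta !=set0) (cTheta : compact Theta)
  (phi : borel_sub Theta0 -> state ab -> E -> state ab)
  (* (A.1) *)
  (A1 : measurable_fun [set: state ab * E * borel_sub Theta0]
          (fun x => phi x.2 x.1.1 x.1.2))
  (* (A.2) *)
  (A2 : forall theta e (s s' : state ab),
          state_le s s' -> state_le (phi theta s e) (phi theta s' e))
  (* (A.3) *)
  (A3 : forall theta (g : state ab -> R), continuous g ->
          forall (sj : nat -> state ab) (s : state ab), sj @ \oo --> s ->
          (fun j => \int[Q]_e g (phi theta (sj j) e)) @ \oo -->
          \int[Q]_e g (phi theta s e))
  (* (A.4) *)
  (A4 : forall (theta : borel_sub Theta0) (kappa : R), 0 < kappa ->
          exists V : set (borel_sub Theta0),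
            [/\ open V, V theta &
             forall theta', V theta' ->
               shock_le (phi theta') (perturb kappa (phi theta)) /\
               shock_le (perturb (- kappa) (phi theta)) (phi theta')])
  (* (A.5), with mu theta the unique invariant probability of phi theta *)
  (mu : borel_sub Theta0 -> probability (state ab) R)
  (A5 : forall theta, unique_invariant_probability Q (phi theta) (mu theta))
  (* data process, through its law *)
  (gammat : probability (seqspace (state ab)) R)
  (Hstat : stationary gammat) (Herg : ergodic gammat)
  (* moment function *)
  (f : state ab -> 'rV[R]_p) (cf : continuous f)
  (mf : forall s s' : state ab, state_le s s' -> vle (f s) (f s'))
  (fbar : 'rV[R]_p)
  (Hfbar : fbar = vmean gammat (fun st : seqspace (state ab) => f (st 0%N)))
  (* limit objective *)
  (G : 'rV[R]_p * 'rV[R]_p -> R) (cG : continuous G)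
  (theta0 : borel_sub Theta0)
  (Htheta0 : unique (minimizer (fun theta => G (vmean (mu theta) f, fbar)))
               theta0)
  (* sample objectives *)
  (GN : nat -> seqspace E * seqspace (state ab) -> 'rV[R]_p * 'rV[R]_p -> R)
  (cGN : forall N, (0 < N)%N -> forall z, continuous (GN N z))
  (HGN : \forall z \ae (gamma \x gammat)%E,
           {uniform, (fun N => GN N z) @ \oo --> G})
  (tau : nat -> seqspace E * seqspace (state ab) -> nat)
  (tau0 : forall N, (0 < N)%N -> forall z, (0 < tau N z)%N)
  (Htau : \forall z \ae (gamma \x gammat)%E, (fun N => tau N z) @ \oo --> \oo)
  (* simulated moments estimator *)
  (thetah : nat -> state ab * (seqspace E * seqspace (state ab)) ->
            borel_sub Theta0)
  (mthetah : forall N, (0 < N)%N ->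
     measurable_fun [set: state ab * (seqspace E * seqspace (state ab))]
       (thetah N))
  (SME : forall N, (0 < N)%N -> \forall z \ae (gamma \x gammat)%E,
     forall s0 : state ab,
       attains_inf
         (fun theta =>
            GN N z (sim_mean f (phi theta) s0 z.1 (tau N z),
                    data_mean f z.2 N))
         (thetah N (s0, z))) :
  \forall z \ae (gamma \x gammat)%E,
    forall s0 : state ab, (fun N => thetah N (s0, z)) @ \oo --> theta0.
Proof.
exact: (estimator_cvg Hgamma A1 A2 A3 A4 A5 cf mf Hstat Herg Hfbar cG Htheta0 HGN
  Htau SME cTheta).
Qed.
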